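(* Assuming $\exists^2$, the combination $M_{\mathsf{usco}}+\Delta$ is in the $\Omega_C$-cluster: any $M_{\mathsf{usco}}$ together with any $\Delta$ and $\exists^2$ computes $\Omega_C$, and $\Omega_C+\exists^2$ computes some $M_{\mathsf{usco}}$ and some $\Delta$.
   Context: Computability is Kleene's higher-order computability (S1–S9), extended to partial functionals; $\exists^2:\mathbb{N}^{\mathbb{N}}\to\{0,1\}$ satisfies $\exists^2(g)=0\leftrightarrow(\exists n)(g(n)=0)$. Sets are given by characteristic functions; $O$ open means every point has a ball $B(x,2^{-k})\subseteq O$; closed means complement open. $\Omega_C$ is defined exactly on closed $X\subseteq2^{\mathbb{N}}$ with value $0$ if $X=\emptyset$ and $1$ otherwise. $f$ is usco if $f(x_0)\ge\limsup_{x\to x_0}f(x)$ for all $x_0$. For $f:[0,1]\to\mathbb{R}$ with nonempty set $C_f$ of continuity points, a modulus of continuity is $F:\mathbb{R}\times\mathbb{N}\to\mathbb{N}$ such that for all $k$, $x\in C_f$, $y\in[0,1]$: $|x-y|<2^{-F(x,k)}\Rightarrow|f(x)-f(y)|<2^{-k}$; $M_{\mathsf{usco}}$ outputs on input usco $f:[0,1]\to\mathbb{R}$ a modulus of continuity for $f$. $O\subseteq[0,1]$ is R2-open if there is $Y:\mathbb{R}\to\mathbb{R}$ with $x\in O\Rightarrow(Y(x)>0\wedge B(x,Y(x))\subseteq O)$ and $Y(x)=0\Rightarrow x\notin O$. An RM-code of an open set $O$ is a pair of real sequences $(a_n),(b_n)$ with $O=\bigcup(a_n,b_n)$. $\Delta$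 is a functional such that for any R2-open $O\subseteq[0,1]$ with R2-representation, $\Delta$ applied to it together with $\exists^2$ computes an RM-code for $O$. *)

(* Defs.v *)
From HB Require Import structures.
From mathcomp Require Import all_boot all_order all_algebra.
From mathcomp Require Import all_classical all_reals all_analysis.
Set Implicit Arguments.
Unset Strict Implicit.
Unset Printing Implicit Defensive.
Import Order.TTheory GRing.Theory Num.Theory.
Import numFieldNormedType.Exports.
Local Open Scope classical_set_scope.
Local Open Scope ring_scope.

(* Finite types: Ty [:: s1; ...; sk] is s1 -> ... -> sk -> N. *)
Inductive ty : Type := Ty of seq ty.

Definition arrow (T : Type) (As : seq Type) : Type :=
  foldr (fun A B => A -> B) T As.

Fixpoint tot (s : ty) : Type := let: Ty l := s in arrow nat (map tot l).

(* Partial functionals: arguments are total, the value may be undefined. *)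
Definition part (s : ty) : Type :=
  let: Ty l := s in arrow (option nat) (map tot l).

Definition tup (l : seq ty) : Type :=
  foldr (fun s T => (tot s * T)%type) unit l.

Fixpoint apply (T : Type) (l : seq ty) : arrow T (map tot l) -> tup l -> T :=
  match l with
  | [::] => fun c _ => c
  | s :: l' => fun f x => @apply T l' (f x.1) x.2
  end.

Fixpoint lift_arrow (l : seq ty) :
    arrow nat (map tot l) -> arrow (option nat) (map tot l) :=
  match l with
  | [::] => fun n => Some n
  | s :: l' => fun f x => @lift_arrow l' (f x)
  end.

Definition lift (s : ty) : tot s -> part s :=
  match s with Ty l => @lift_arrow l end.

Definition tyN : ty := Ty [::].
Definition ty1 : ty := Ty [:: tyN].
Definition ty2 : ty := Ty [:: ty1].
Definition ty11 : ty := Ty [:: ty1; tyN].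

Definition arg : Type := {s : ty & part s}.
Definition parg (s : ty) (phi : part s) : arg := existT part s phi.
Definition targ (s : ty) (x : tot s) : arg := parg (lift x).
Definition num (a : nat) : arg := @targ tyN a.

Fixpoint args_of (l : seq ty) : tup l -> seq arg :=
  match l with
  | [::] => fun _ => [::]
  | s :: l' => fun x => targ x.1 :: @args_of l' x.2
  end.

(* Goedel numbers of tuples, so that indices are literally natural numbers.
   Locked because the unary numerals are far too large to be evaluated. *)
HB.lock Definition idx : seq nat -> nat := CodeSeq.code.

(* [kleene e G n] is {e}(G) = n, inductively generated by Kleene's S1-S9.  S8 is
   stated for all finite types: the oracle phi is applied to the functionals
   lambda xi. {e_i}(xi, phi, G), which must all be total, and phi must be
   defined there.  [kleene_args es G gs] says that the tuple of total
   functionals gs is computed in this way by the indices es. *)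
Inductive kleene : nat -> seq arg -> nat -> Prop :=
| S1 a G :
    kleene (idx [:: 1%N]) (num a :: G) a.+1
| S2 q G :
    kleene (idx [:: 2; q]) G q
| S3 a G :
    kleene (idx [:: 3]) (num a :: G) a
| S4 e0 e1 G b n :
    kleene e1 G b -> kleene e0 (num b :: G) n ->
    kleene (idx [:: 4; e0; e1]) G n
| S5_0 e0 e1 G n :
    kleene e0 G n ->
    kleene (idx [:: 5; e0; e1]) (num 0 :: G) n
| S5_S e0 e1 a G b n :
    kleene (idx [:: 5; e0; e1]) (num a :: G) b ->
    kleene e1 (num b :: num a :: G) n ->
    kleene (idx [:: 5; e0; e1]) (num a.+1 :: G) n
| S6 e p G n :
    perm_eq p (iota 0 (size G)) ->
    kleene e [seq nth (num 0) G i | i <- p] n ->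
    kleene (idx [:: 6, e & p]) G n
| S7 (phi : part ty1) a G n :
    phi a = Some n ->
    kleene (idx [:: 7]) (parg phi :: num a :: G) n
| S8 es (l : seq ty) (phi : part (Ty l)) (gs : tup l) G n :
    kleene_args es (parg phi :: G) gs ->
    @apply (option nat) l phi gs = Some n ->
    kleene (idx (8 :: es)) (parg phi :: G) n
| S9 m e G n :
    (m <= size G)%N ->
    kleene e (take m G) n ->
    kleene (idx [:: 9; m]) (num e :: G) n
with kleene_args : seq nat -> seq arg -> forall l : seq ty, tup l -> Prop :=
| kleene_nil G :
    @kleene_args [::] G [::] tt
| kleene_cons e es G (k l : seq ty) (g : tot (Ty k)) (gs : tup l) :
    (forall xi : tup k, kleene e (args_of xi ++ G) (@apply nat k g xi)) ->
    kleene_args es G gs ->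
    @kleene_args (e :: es) G (Ty k :: l) (g, gs).

(* Kleene equality with psi, uniformly in the arguments of psi: in particular
   the computation must diverge where psi is undefined. *)
Definition computable_in (s : ty) (psi : part s) (oracles : seq arg) : Prop :=
  match s return part s -> Prop with
  | Ty l => fun psi => exists e : nat, forall (xi : tup l) (n : nat),
      kleene e (args_of xi ++ oracles) n <-> @apply (option nat) l psi xi = Some n
  end psi.

Definition E2 : tot ty2 :=
  fun g : nat -> nat => if `[< exists n, g n = 0%N >] then 0%N else 1%N.

(* The subset of Cantor space with characteristic function Xh; the values of
   Xh outside {0,1}-valued sequences are irrelevant. *)
Definition cseq (z : cantor_space) : nat -> nat := fun n => nat_of_bool (z n).

Definition cset (Xh : tot ty2) : set cantor_space :=
  [set z | Xh (cseq z) = 1%N].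

Definition is_char (Xh : tot ty2) : Prop :=
  forall z : cantor_space, (Xh (cseq z) <= 1)%N.

Definition Omega_C : part (Ty [:: ty2]) :=
  fun Xh : tot ty2 =>
    if `[< is_char Xh /\ closed (cset Xh) >]
    then Some (if `[< cset Xh = set0 >] then 0%N else 1%N)
    else None.

Definition int_of_code (c : nat) : int :=
  if odd c then Negz c./2 else Posz c./2.

Definition unitI (R : realType) : set R := `[0, 1]%classic.
Arguments unitI R : clear implicits.

(* Names of reals are fast Cauchy sequences of (codes of) dyadic rationals;
   the n-th entry c stands for int_of_code c / 2^n. *)
Definition real_name (R : realType) (x : tot ty1) (a : R) : Prop :=
  forall n : nat, `|a - (int_of_code (x n))%:~R / 2 ^+ n| <= 2 ^- n.

(* Name of f restricted to D. *)
Definition fun_name (R : realType) (D : set R) (fh : tot ty11) (f : R -> R) :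
    Prop :=
  forall (x : tot ty1) (a : R), D a -> real_name x a -> real_name (fh x) (f a).

Definition set_name (R : realType) (Oh : tot ty2) (O : set R) : Prop :=
  forall (x : tot ty1) (a : R),
    real_name x a -> Oh x = (if `[< O a >] then 1%N else 0%N).

Definition usco (R : realType) (f : R -> R) : Prop :=
  forall x0 : R, unitI R x0 ->
    (limf_esup (EFin \o f) (within (unitI R) x0^') <= (f x0)%:E)%E.

Definition cont_points (R : realType) (f : R -> R) : set R :=
  [set x | unitI R x /\ f @ within (unitI R) (nbhs x) --> f x].

Definition is_modulus (R : realType) (f : R -> R) (F : R -> nat -> nat) : Prop :=
  forall (k : nat) (x y : R), cont_points f x -> unitI R y ->
    `|x - y| < 2 ^- F x k -> `|f x - f y| < 2 ^- k.

Definition ty_Musco : ty := Ty [:: ty11; ty1; tyN].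

(* M acts on names, but the modulus depends only on the function named, and
   its value at (a, k) only on the real a. *)
Definition is_Musco (R : realType) (M : part ty_Musco) : Prop :=
  exists F : (R -> R) -> R -> nat -> nat,
    forall f : R -> R, usco f ->
      is_modulus f (F f) /\
      forall (fh : tot ty11), fun_name (unitI R) fh f ->
      forall (x : tot ty1) (a : R) (k : nat), real_name x a ->
        M fh x k = Some (F f a k).

Definition R2_open (R : realType) (O : set R) (Y : R -> R) : Prop :=
  O `<=` unitI R /\
  forall x : R, (O x -> 0 < Y x /\ ball x (Y x) `<=` O) /\
                (Y x = 0 -> ~ O x).

Definition RM_code (R : realType) (O : set R) (a b : nat -> R) : Prop :=
  O = \bigcup_n `]a n, b n[%classic.

(* Inputs: O, its R2-representation Y, and exists^2.  Outputs: names of a_n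
   (selector 0) and b_n (selector 1), evaluated at the last argument. *)
Definition ty_Delta : ty := Ty [:: ty2; ty11; ty2; tyN; tyN; tyN].

Definition computes_name (R : realType) (x : nat -> option nat) (a : R) : Prop :=
  exists2 y : tot ty1, real_name y a & forall m, x m = Some (y m).

Definition is_Delta (R : realType) (D : part ty_Delta) : Prop :=
  exists a b : set R -> (R -> R) -> nat -> R,
    forall (O : set R) (Y : R -> R), R2_open O Y ->
      RM_code O (a O Y) (b O Y) /\
      forall (Oh : tot ty2) (Yh : tot ty11),
        set_name Oh O -> fun_name setT Yh Y ->
        forall n : nat,
          computes_name (D Oh Yh E2 0%N n) (a O Y n) /\
          computes_name (D Oh Yh E2 1%N n) (b O Y n).

(* Main.v *)
From mathcomp Require Import all_boot all_order all_algebra.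
From mathcomp Require Import all_classical all_reals all_analysis.
From mathcomp Require Import zify ring lra.
From Stdlib Require Import Eqdep.
Require Import Defs.
Set Implicit Arguments.
Unset Strict Implicit.
Unset Printing Implicit Defensive.

(** From a modulus functional to Omega_C: embed Cantor space in [1/3, 2/3] by
    z |-> sum_i (z_i + 1) 4^(-i-1).  For closed X the indicator of the image is
    usco and continuous off the image, so a modulus of it gives, at each such
    point, a radius on which the image is avoided; hence the complement of the
    image in ]0, 1[ is R2-open, and X is empty iff the code delivered by Delta
    covers [1/4, 3/4], which by compactness is arithmetical in the code.
    Divergence outside the domain of Omega_C is forced by S8: an oracle call
    diverges unless its functional argument is total, so a call to M can check
    for all (z, z') that z' is outside X whenever z is and z' agrees with z up
    to the computed modulus.
    From Omega_C to the other two: for usco f the set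
    {y | |x - y| <= 2^-m, f y >= f x + 2^-k} is closed, so Omega_C decides the
    upper half of the modulus condition; {f < q} is open, so the lower half
    only concerns dyadic points and is decided by E2.  A code for an open set
    lists the dyadic intervals whose closure is contained in it, which Omega_C
    decides. *)

(** * Kleene computations *)

(** Two obstacles shape the proof. Computability is Kleene equality, so a program must diverge off
    the domain of its functional, while the programs make sense only on good inputs. Contexts are
    therefore indexed by a type [W] that can be cut down to the good inputs, and divergence is
    treated apart: for [Omega_C], S4 runs a guard before the decision; M and Delta, when they are
    constructed, are defined as whatever an index computes. The other obstacle is that membership of
    a real in the image has to be decided from an arbitrary name of it. Base 4 with digits 1 and 2
    keeps every tail of the expansion inside [5/16, 11/16], so an approximation with error 1/4
    already determines all earlier digits; a binary embedding would be ambiguous at carries.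
    Precision k = 0 of the modulus is enough, since an indicator whose values at two points differ
    by less than 1 is equal there. *)

Lemma idx_inj : injective idx.
Proof. by rewrite idx.unlock => s t /(can_inj CodeSeq.codeK). Qed.

(** A left inverse of [num], which avoids inverting an equality of dependent pairs. *)
Definition argnat (x : arg) : nat :=
  let: existT s v := x in
  match s return part s -> nat with
  | Ty [::] => fun o => odflt 0 o
  | _ => fun _ => 0
  end v.

Lemma num_inj : injective num.
Proof. by move=> a b /(congr1 argnat). Qed.

(** The type of the second component depends on [s], so this rests on uniqueness of identity
    proofs. *)
Lemma parg_inj s : injective (@parg s).
Proof. by move=> u v /(inj_pair2 ty part s). Qed.

Lemma parg_inj_ty s t (u : part s) (v : part t) : parg u = parg v -> s = t.
Proof. by case. Qed.

Lemma apply_inj (T : Type) l (f g : arrow T (map tot l)) :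
  (forall xi, apply f xi = apply g xi) -> f = g.
Proof.
elim: l f g => [|s l IH] f g /= fg; first exact: (fg tt).
by apply/funext => x; apply: IH => xi; exact: (fg (x, xi)).
Qed.

(** Stated on the decoded list, so that inversion computes although [idx] is locked. A list of any
    other shape is the index of no rule, hence [False]. *)
Definition kleene_inv_spec (s : seq nat) (G : seq arg) (n : nat) : Prop :=
  match s with
  | [:: 1] => exists a G', G = num a :: G' /\ n = a.+1
  | [:: 2; q] => n = q
  | [:: 3] => exists G', G = num n :: G'
  | [:: 4; e0; e1] => exists2 b, kleene e1 G b & kleene e0 (num b :: G) n
  | [:: 5; e0; e1] =>
      (exists2 G', G = num 0 :: G' & kleene e0 G' n) \/
      (exists a G' b, [/\ G = num a.+1 :: G',
         kleene (idx [:: 5; e0; e1]) (num a :: G') b &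
         kleene e1 (num b :: num a :: G') n])
  | 6 :: e :: p =>
      perm_eq p (iota 0 (size G)) /\
      kleene e [seq nth (num 0) G i | i <- p] n
  | [:: 7] => exists phi a G',
      G = @parg ty1 phi :: num a :: G' /\ phi a = Some n
  | 8 :: es => exists l phi (gs : tup l) G',
      [/\ G = @parg (Ty l) phi :: G', kleene_args es G gs &
          @apply (option nat) l phi gs = Some n]
  | [:: 9; m] => exists e G',
      [/\ G = num e :: G', m <= size G' & kleene e (take m G') n]
  | _ => False
  end.

Lemma kleene_inv s G n : kleene (idx s) G n -> kleene_inv_spec s G n.
Proof.
move eqe : (idx s) => e H; case: H eqe => {e G n}.
- by move=> a G /idx_inj ->; exists a, G.
- by move=> q G /idx_inj ->.
- by move=> a G /idx_inj ->; exists G.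
- by move=> e0 e1 G b n ? ? /idx_inj ->; exists b.
- by move=> e0 e1 G n ? /idx_inj ->; left; exists G.
- by move=> e0 e1 a G b n ? ? /idx_inj ->; right; exists a, G, b.
- by move=> e p G n ? ? /idx_inj ->.
- by move=> phi a G n ? /idx_inj ->; exists phi, a, G.
- by move=> es l phi gs G n ? ? /idx_inj ->; exists l, phi, gs, G.
- by move=> m e G n ? ? /idx_inj ->; exists e, G.
Qed.

Lemma kleene_args_inv es G l (gs : tup l) : kleene_args es G gs ->
  match l return tup l -> Prop with
  | [::] => fun _ => es = [::]
  | Ty k :: l' => fun gs => exists e es', [/\ es = e :: es',
      forall xi : tup k, kleene e (args_of xi ++ G) (@apply nat k gs.1 xi) &
      kleene_args es' G gs.2]
  end gs.
Proof. by case=> // e {}es {}G k {}l g {}gs Hg Hgs; exists e, es. Qed.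

Scheme kleene_mut := Minimality for kleene Sort Prop
  with kleene_args_mut := Minimality for kleene_args Sort Prop.

Lemma cons_num_inj a b G G' : num a :: G = num b :: G' -> a = b /\ G = G'.
Proof.
by move=> E; split; [apply: num_inj; apply: (congr1 (head (num 0)) E) |
  apply: (congr1 behead E)].
Qed.

(** Mutual induction with [kleene_args]: in the S8 case the two tuples of functionals agree at all
    arguments, hence are equal by extensionality, and the oracle is single-valued. *)
Lemma kleene_det e G n n' : kleene e G n -> kleene e G n' -> n = n'.
Proof.
move=> H; move: n'.
apply: (kleene_mut
  (P := fun e G n => forall n', kleene e G n' -> n = n')
  (P0 := fun es G l gs => forall gs', kleene_args es G gs' -> gs = gs') _ _ _
  _ _ _ _ _ _ _ _ _ H) => {e G n H}.
- by move=> a G n /kleene_inv[b [G' [/cons_num_inj[-> _] ->]]].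
- by move=> q G n /kleene_inv.
- by move=> a G n /kleene_inv[G' /cons_num_inj[]].
- move=> e0 e1 G b n _ IH1 _ IH0 n' /kleene_inv[b' /IH1 <-]; exact: IH0.
- move=> e0 e1 G n _ IH n' /kleene_inv[[G' /cons_num_inj[_ <-]]|]; first exact: IH.
  by move=> [a [G' [b [/cons_num_inj[]]]]].
- move=> e0 e1 a G b n _ IH1 _ IH0 n' /kleene_inv[[G' /cons_num_inj[]//]|].
  move=> [a' [G' [b' [/cons_num_inj[[<-] <-] /IH1 <-]]]]; exact: IH0.
- by move=> e p G n _ _ IH n' /kleene_inv[_ /IH].
- move=> phi a G n Hn n' /kleene_inv[phi' [a' [G' [E]]]].
  have [<- _] := cons_num_inj (congr1 behead E).
  by have /parg_inj <- := congr1 (head (num 0)) E; rewrite Hn => -[].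
- move=> es l phi gs G n _ IH Hn n' /kleene_inv[l' [phi' [gs' [G' [E]]]]].
  have := congr1 (head (num 0)) E; rewrite [head _ _]/= [head _ _]/= => E1.
  have [El] := parg_inj_ty E1; subst l'; rewrite -(parg_inj E1).
  by move=> /IH <-; rewrite Hn => -[].
- move=> m e G n _ _ IH n' /kleene_inv[e' [G' [/cons_num_inj[<- <-] _]]].
  exact: IH.
- move=> G gs; by case: gs.
- move=> e es G k l g gs _ IHg _ IHgs [g' gs'] /kleene_args_inv/=.
  move=> [e' [es' [[<- <-] Hg /IHgs <-]]]; congr pair.
  by apply: apply_inj => xi; apply: IHg.
Qed.

Lemma kleene_args_det es G l (gs gs' : tup l) :
  kleene_args es G gs -> kleene_args es G gs' -> gs = gs'.
Proof.
elim: l es gs gs' => [|[k] l IH] es gs gs'; first by case: gs gs' => -[].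
case: gs gs' => g gs [g' gs'] /kleene_args_inv/= [e [es0 [-> Hg Hgs]]].
move=> /kleene_args_inv/= [e' [es' [[<- <-] Hg' Hgs']]].
congr pair; last exact: IH Hgs Hgs'.
by apply: apply_inj => xi; apply: kleene_det (Hg xi) (Hg' xi).
Qed.

(* S6 brings the selected arguments to the front; S9, called with the constant
   index e, drops the others. *)
Lemma kleene_sel N sel e : uniq sel -> all (gtn N) sel ->
  exists e', forall G n, size G = N ->
    kleene e' G n <-> kleene e [seq nth (num 0) G i | i <- sel] n.
Proof.
move=> sel_uniq sel_lt.
pose p := sel ++ [seq i <- iota 0 N | i \notin sel].
have pP : perm_eq p (iota 0 N).
  apply: uniq_perm; [|exact: iota_uniq|].
    rewrite cat_uniq sel_uniq filter_uniq ?iota_uniq// andbT.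
    by apply/hasPn => i; rewrite mem_filter => /andP[].
  move=> i; rewrite mem_cat mem_filter mem_iota add0n/=.
  case: (boolP (i \in sel)) => //= /(allP sel_lt) /= H; by rewrite H.
have takeE G : take (size sel) [seq nth (num 0) G i | i <- p] =
    [seq nth (num 0) G i | i <- sel].
  by rewrite map_cat take_size_cat// size_map.
have le_sel G : (size sel <= size [seq nth (num 0) G i | i <- p])%N.
  by rewrite size_map size_cat leq_addr.
exists (idx [:: 6, idx [:: 4; idx [:: 9; size sel]; idx [:: 2; e]] & p]).
move=> G n sG; split.
  move=> /kleene_inv[_ /kleene_inv[b /kleene_inv/= -> /kleene_inv]].
  by move=> [e' [G' [/cons_num_inj[<- <-] _]]]; rewrite takeE.
move=> H; apply: S6; first by rewrite sG.
by apply: S4; [apply: S2 | apply: S9; rewrite ?le_sel ?takeE].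
Qed.

(** The functionals of S8 run with their own arguments put in front of G, so the selection is
    shifted past those and extended by the identity on them. *)
Lemma kleene_args_sel l N sel es : uniq sel -> all (gtn N) sel ->
  exists es', forall G (gs : tup l), size G = N ->
    kleene_args es' G gs <->
    kleene_args es [seq nth (num 0) G i | i <- sel] gs.
Proof.
move=> sel_uniq sel_lt; elim: l es => [|[k] l IH] es.
  by exists es => G gs _; split=> /kleene_args_inv/= ->; case: gs; constructor.
case: es => [|e es].
  by exists [::] => G gs _; split=> /kleene_args_inv[e [es []]].
have [es' Hes'] := IH es.
pose m := size k.
have [|| e' He'] := @kleene_sel (m + N) (iota 0 m ++ map (addn m) sel) e.
- rewrite cat_uniq iota_uniq (map_inj_uniq (@addnI m)) sel_uniq andbT/=.
  apply/hasPn => j /mapP[i _ {j}->].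
  by rewrite /= mem_iota add0n/= -leqNgt leq_addr.
- rewrite all_cat; apply/andP; split.
    by apply/allP => i; rewrite mem_iota add0n /= => /ltn_addr; apply.
  by apply/allP => j /mapP[i /(allP sel_lt) /= H {j}->]; rewrite /= ltn_add2l.
have size_args (xi : tup k) : size (args_of xi) = m.
  rewrite /m; clear -k; elim: k xi => //= s k IHk xi.
  by rewrite IHk.
have selE (xi : tup k) G : [seq nth (num 0) (args_of xi ++ G) i
     | i <- iota 0 m ++ map (addn m) sel] =
    args_of xi ++ [seq nth (num 0) G i | i <- sel].
  rewrite map_cat -map_comp map_nth_iota0 ?size_cat ?size_args ?leq_addr//.
  rewrite take_size_cat//; congr cat; apply: eq_map => i /=.
  by rewrite nth_cat size_args ltnNge leq_addr/= addKn.
exists (e' :: es') => G gs sG; split.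
  case: gs => g gs /kleene_args_inv/= [_ [_ [[<- <-] Hg /Hes']]] Hgs.
  constructor; last exact: Hgs.
  by move=> xi; rewrite -selE -He' ?size_cat ?size_args ?sG.
case: gs => g gs /kleene_args_inv/= [_ [_ [[<- <-] Hg Hgs]]].
constructor; last by apply/Hes'.
by move=> xi; rewrite He' ?size_cat ?size_args ?sG// selE.
Qed.

(** S8 applies only the first argument of the list. The oracle is moved to the front, and the
    indices [es] are composed with the inverse permutation so that they still refer to the original
    G. *)
Lemma kleene_app l N i es : (i < N)%N ->
  exists e, forall G (phi : part (Ty l)) n, size G = N ->
    nth (num 0) G i = parg phi ->
    kleene e G n <->
    exists2 gs : tup l, kleene_args es G gs &
      @apply (option nat) l phi gs = Some n.
Proof.
move=> iN.
have [s sdef sP] : exists2 s, s = i :: rem i (iota 0 N) & perm_eq (iota 0 N) s.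
  by exists (i :: rem i (iota 0 N)); rewrite ?perm_to_rem ?mem_iota.
have s_uniq : uniq s by rewrite -(perm_uniq sP) iota_uniq.
have s_mem j : (j \in s) = (j < N)%N.
  by rewrite -(perm_mem sP) mem_iota add0n.
have s_size : size s = N by rewrite -(perm_size sP) size_iota.
have s_lt : all (gtn N) s by apply/allP => j; rewrite s_mem.
(* The inverse of the permutation [s]. *)
pose r := [seq index j s | j <- iota 0 N].
have r_uniq : uniq r.
  rewrite map_inj_in_uniq ?iota_uniq// => j k.
  rewrite !mem_iota !add0n/= => jN kN /(congr1 (nth 0 s)).
  by rewrite !nth_index ?s_mem.
have r_lt : all (gtn N) r.
  apply/allP => k /mapP[j]; rewrite mem_iota add0n/= => jN {k}->.
  by have := s_mem j; rewrite jN -index_mem s_size.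
have rE G : size G = N -> [seq nth (num 0) [seq nth (num 0) G j | j <- s] k
    | k <- r] = G.
  move=> sG; rewrite -map_comp -[RHS](mkseq_nth (num 0)) /mkseq sG.
  apply/eq_in_map => j /=; rewrite mem_iota add0n/= => jN.
  by rewrite (nth_map 0) ?nth_index ?s_mem// index_mem s_mem.
have [es' Hes'] := @kleene_args_sel l N r es r_uniq r_lt.
have [e He] := @kleene_sel N s (idx (8 :: es')) s_uniq s_lt.
exists e => G phi n sG Gi; rewrite He//.
have Gs : [seq nth (num 0) G j | j <- s] =
    parg phi :: [seq nth (num 0) G j | j <- rem i (iota 0 N)].
  by rewrite sdef /= Gi.
split.
  move=> /kleene_inv[l' [phi' [gs' [G' [E]]]]]; move: E; rewrite Gs.
  set H := map _ _ => E; have := congr1 (head (num 0)) E.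
  rewrite [head _ _]/= [head _ _]/= => E1.
  have [El] := parg_inj_ty E1; subst l'; rewrite -(parg_inj E1) -Gs.
  by move=> /Hes'; rewrite size_map => /(_ s_size); rewrite rE//; exists gs'.
move=> [gs Hgs phiE]; rewrite Gs; apply: S8 phiE; rewrite -Gs Hes' ?rE//.
by rewrite size_map.
Qed.

(** * Computability uniformly in parameters *)

Definition ctx (W : Type) := seq (W -> arg).

Definition vals W (Γ : ctx W) (w : W) : seq arg := [seq v w | v <- Γ].

Definition has W (Γ : ctx W) (v : W -> arg) : Prop :=
  exists2 i, (i < size Γ)%N & nth (fun=> num 0) Γ i = v.

(** The new variable comes first, as in S4, S5 and S8, which prepend to the argument list. *)
Definition push (s : ty) W (Γ : ctx W) : ctx (tot s * W) :=
  (fun p => targ p.1) :: [seq v \o snd | v <- Γ].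
Arguments push s {W} Γ.

Definition pcomp W (Γ : ctx W) (F : W -> option nat) : Prop :=
  exists e, forall w n, kleene e (vals Γ w) n <-> F w = Some n.

(** One index serves all parameters [w]. Convergence is all that is asked, and [kleene_det] excludes
    other values; [pcomp] is the notion that also records divergence. *)
Definition comp W (Γ : ctx W) (f : W -> nat) : Prop :=
  exists e, forall w, kleene e (vals Γ w) (f w).

Definition acomps l W (Γ : ctx W) (gs : W -> tup l) : Prop :=
  exists es, forall w, kleene_args es (vals Γ w) (gs w).

Definition acomp k W (Γ : ctx W) (g : W -> tot (Ty k)) : Prop :=
  exists e, forall w (xi : tup k),
    kleene e (args_of xi ++ vals Γ w) (@apply nat k (g w) xi).

Definition compP W (Γ : ctx W) (P : W -> Prop) : Prop :=
  comp Γ (fun w => nat_of_bool `[< P w >]).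

Definition comp1 W (Γ : ctx W) (x : W -> nat -> nat) : Prop :=
  comp (push tyN Γ) (fun p => x p.2 p.1).

Lemma size_vals W (Γ : ctx W) w : size (vals Γ w) = size Γ.
Proof. exact: size_map. Qed.

Lemma vals_push s W (Γ : ctx W) p : vals (push s Γ) p = targ p.1 :: vals Γ p.2.
Proof. by rewrite /vals /push /= -map_comp. Qed.

Lemma nth_vals i W (Γ : ctx W) w : (i < size Γ)%N ->
  nth (num 0) (vals Γ w) i = nth (fun=> num 0) Γ i w.
Proof. by move=> iN; rewrite (nth_map (fun=> num 0)). Qed.

Section context.
Variables (W : Type) (Γ : ctx W).

Lemma has_push s v : has Γ v -> has (push s Γ) (fun p => v p.2).
Proof.
by move=> [i iN <-]; exists i.+1; rewrite /= ?size_map// (nth_map (fun=> num 0)).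
Qed.

Lemma has_top s : has (push s Γ) (fun p => targ p.1).
Proof. by exists 0. Qed.

Lemma pcomp_comp F f : pcomp Γ F -> (forall w, F w = Some (f w)) -> comp Γ f.
Proof. by move=> [e He] Ff; exists e => w; apply/He; rewrite Ff. Qed.

Lemma comp_ext f g : comp Γ f -> f =1 g -> comp Γ g.
Proof. by move=> [e He] fg; exists e => w; rewrite -fg. Qed.

Lemma comp_const c : comp Γ (fun=> c).
Proof. by exists (idx [:: 2; c]) => w; apply: S2. Qed.

Lemma comp_let t f : comp Γ t -> comp (push tyN Γ) f ->
  comp Γ (fun w => f (t w, w)).
Proof.
move=> [e He] [e' He']; exists (idx [:: 4; e'; e]) => w.
by apply: S4 (He w) _; have := He' (t w, w); rewrite vals_push.
Qed.

Lemma pcomp_let T F : pcomp Γ T -> pcomp (push tyN Γ) F ->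
  pcomp Γ (fun w => obind (fun b => F (b, w)) (T w)).
Proof.
move=> [e He] [e' He']; exists (idx [:: 4; e'; e]) => w n; split.
  move=> /kleene_inv[b /He -> /=]; have := He' (b, w) n.
  by rewrite vals_push => <-.
case E: (T w) => [b|//] /= H.
apply: S4; first by apply/He; exact: E.
by have := He' (b, w) n; rewrite vals_push => ->.
Qed.

Lemma comp_let1 t f : comp Γ t -> comp1 Γ f -> comp Γ (fun w => f w (t w)).
Proof. by move=> ct cf; exact: comp_let ct cf. Qed.

Lemma comp_push s f : comp Γ f -> comp (push s Γ) (fun p => f p.2).
Proof.
move=> [e He].
have [|| e' He'] := @kleene_sel (size Γ).+1 (iota 1 (size Γ)) e.
- exact: iota_uniq.
- by apply/allP => i; rewrite mem_iota => /andP[].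
exists e' => p; rewrite He' vals_push/= ?size_vals//.
rewrite map_nth_iota ?add1n/= ?size_vals//.
  by rewrite drop0 take_oversize ?size_vals.
by rewrite subn1.
Qed.

Lemma comp_num v : has Γ (fun w => num (v w)) -> comp Γ v.
Proof.
move=> [i iN Gi].
have [|| e He] := @kleene_sel (size Γ) [:: i] (idx [:: 3]) => //=.
  by rewrite iN.
exists e => w; rewrite He ?size_vals//= nth_vals// Gi; exact: S3.
Qed.

Lemma comp_succ t : comp Γ t -> comp Γ (fun w => (t w).+1).
Proof.
move=> [e He]; exists (idx [:: 4; idx [:: 1]; e]) => w.
by apply: S4 (He w) _; exact: S1.
Qed.

(** The order of the variables is that of S5: previous value first, then the counter. The last
    hypothesis lets a caller name the recursion by a closed form [g]. *)
Lemma comp_rec f0 (f1 : W -> nat -> nat -> nat) t g : comp Γ f0 ->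
  comp (push tyN (push tyN Γ)) (fun p => f1 p.2.2 p.2.1 p.1) -> comp Γ t ->
  (forall w, nat_rect (fun=> nat) (f0 w) (f1 w) (t w) = g w) -> comp Γ g.
Proof.
move=> [e0 H0] [e1 H1] ct fg; apply: comp_ext fg.
apply: (comp_let1 ct (f := fun w n => nat_rect (fun=> nat) (f0 w) (f1 w) n)).
exists (idx [:: 5; e0; e1]) => -[n w]; rewrite vals_push /=.
elim: n => [|n IH] /=; first exact: S5_0.
apply: S5_S IH _; move: (nat_rect _ _ _ _) => b.
by have := H1 (b, (n, w)); rewrite !vals_push.
Qed.

Lemma acomp0 g : comp Γ g -> @acomp [::] W Γ g.
Proof. by move=> [e He]; exists e => w xi; apply: He. Qed.

Lemma acomp1 s g : comp (push s Γ) (fun p => g p.2 p.1) ->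
  @acomp [:: s] W Γ g.
Proof.
move=> [e He]; exists e => w [x []].
by have := He (x, w); rewrite vals_push.
Qed.

Lemma acomp2 s s' g :
  comp (push s (push s' Γ)) (fun p => g p.2.2 p.1 p.2.1) ->
  @acomp [:: s; s'] W Γ g.
Proof.
move=> [e He]; exists e => w [x [y []]].
by have := He (x, (y, w)); rewrite !vals_push.
Qed.

Lemma acomps_nil : @acomps [::] W Γ (fun=> tt).
Proof. by exists [::] => w; constructor. Qed.

Lemma acomps_cons k l g gs : @acomp k W Γ g -> @acomps l W Γ gs ->
  @acomps (Ty k :: l) W Γ (fun w => (g w, gs w)).
Proof.
by move=> [e He] [es Hes]; exists (e :: es) => w; constructor=> //; apply: He.
Qed.

Lemma pcomp_app l (phi : W -> part (Ty l)) gs :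
  has Γ (fun w => parg (phi w)) -> @acomps l W Γ gs ->
  pcomp Γ (fun w => @apply (option nat) l (phi w) (gs w)).
Proof.
move=> [i iN Gi] [es Hes]; have [e He] := @kleene_app l (size Γ) i es iN.
exists e => w n; rewrite (He _ (phi w)) ?size_vals ?nth_vals ?Gi//; split.
  by move=> [gs' /(kleene_args_det (Hes w)) <-].
by exists (gs w).
Qed.

Lemma comp_app1 x t : has Γ (fun w => @targ ty1 (x w)) -> comp Γ t ->
  comp Γ (fun w => x w (t w)).
Proof.
move=> hx ct; pose gs w := (t w, tt) : tup [:: tyN].
apply: (pcomp_comp (pcomp_app (gs := gs) hx _)) => //.
by apply: acomps_cons; [apply: acomp0 | apply: acomps_nil].
Qed.

Lemma comp_app2 X x : has Γ (fun w => @targ ty2 (X w)) -> comp1 Γ x ->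
  comp Γ (fun w => X w (x w)).
Proof.
move=> hX cx; pose gs w := (x w, tt) : tup [:: ty1].
apply: (pcomp_comp (pcomp_app (gs := gs) hX _)) => //.
by apply: acomps_cons; [apply: acomp1 | apply: acomps_nil].
Qed.

Lemma comp_app11 f x t : has Γ (fun w => @targ ty11 (f w)) -> comp1 Γ x ->
  comp Γ t -> comp Γ (fun w => f w (x w) (t w)).
Proof.
move=> hf cx ct; pose gs w := (x w, (t w, tt)) : tup [:: ty1; tyN].
apply: (pcomp_comp (pcomp_app (gs := gs) hf _)) => //.
apply: acomps_cons; first exact: acomp1.
by apply: acomps_cons; [apply: acomp0 | apply: acomps_nil].
Qed.

End context.

(** * Arithmetic and propositional connectives *)

Section arithmetic.
Variables (W : Type) (Γ : ctx W).
Implicit Types (a b t : W -> nat) (P Q : W -> Prop).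

Lemma comp_top W' (Δ : ctx W') : comp (push tyN Δ) (fun p => p.1).
Proof. exact: comp_num (has_top Δ tyN). Qed.

Lemma comp_snd W' (Δ : ctx W') : comp (push tyN (push tyN Δ)) (fun p => p.2.1).
Proof. exact: comp_push (comp_top Δ). Qed.

Lemma comp_add a b : comp Γ a -> comp Γ b -> comp Γ (fun w => a w + b w).
Proof.
move=> ca cb.
refine (comp_rec (f1 := fun _ _ r => r.+1) ca _ cb _).
  by apply: comp_succ; apply: comp_top.
by move=> w; elim: (b w) => [|n] /=; rewrite ?addn0 ?addnS// => ->.
Qed.

Lemma comp_sub a b : comp Γ a -> comp Γ b -> comp Γ (fun w => a w - b w).
Proof.
move=> ca cb.
refine (comp_rec (f1 := fun _ _ r => r.-1) ca _ cb _).
  (* The predecessor is itself a recursion, whose step returns its counter. *)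
  have c1 := comp_top (push tyN Γ).
  refine (comp_rec (f1 := fun _ n _ => n) (comp_const _ 0) _ c1 _).
    exact: comp_snd.
  by case=> -[].
by move=> w; elim: (b w) => [|n] /=; rewrite ?subn0 ?subnS// => ->.
Qed.

End arithmetic.

Section arithmetic2.
Variables (W : Type) (Γ : ctx W).
Implicit Types (a b t : W -> nat) (P Q : W -> Prop).

Lemma comp_mul a b : comp Γ a -> comp Γ b -> comp Γ (fun w => a w * b w).
Proof.
move=> ca cb.
refine (comp_rec (f1 := fun w _ r => r + a w) (comp_const Γ 0) _ cb _).
  by apply: comp_add; [exact: comp_top | exact: (comp_push tyN (comp_push tyN ca))].
by move=> w; elim: (b w) => [|n] /=; rewrite ?muln0 ?mulnS// addnC => ->.
Qed.

Lemma comp_exp a b : comp Γ a -> comp Γ b -> comp Γ (fun w => a w ^ b w).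
Proof.
move=> ca cb; have ca' := comp_push tyN (comp_push tyN ca).
refine (comp_rec (f1 := fun w _ r => a w * r) (comp_const Γ 1) _ cb _).
  apply: (@comp_ext _ _ (fun p : nat * (nat * W) => p.1 * a p.2.2)).
    refine (comp_rec (f1 := fun p _ r => r + a p.2.2) (comp_const _ 0) _
      (comp_top _) _).
      by apply: comp_add; [exact: comp_top | exact: (comp_push tyN (comp_push tyN ca'))].
    by move=> p; elim: p.1 => [|n] //= ->; rewrite mulSn addnC.
  by move=> p; rewrite mulnC.
by move=> w; elim: (b w) => [|n] //=; rewrite expnS => ->.
Qed.

Lemma comp_odd a : comp Γ a -> comp Γ (fun w => nat_of_bool (odd (a w))).
Proof.
move=> ca.
refine (comp_rec (f1 := fun _ _ r => 1 - r) (comp_const Γ 0) _ ca _).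
  by apply: comp_sub; [exact: comp_const | exact: comp_top].
by move=> w; elim: (a w) => [|n] //= ->; case: odd.
Qed.

Lemma comp_half a : comp Γ a -> comp Γ (fun w => (a w)./2).
Proof.
move=> ca.
refine (comp_rec (f1 := fun _ n r => odd n + r) (comp_const Γ 0) _ ca _).
  apply: comp_add; last exact: comp_top.
  apply: (@comp_push _ (push tyN Γ) tyN (fun p => nat_of_bool (odd p.1))).
  have c1 := comp_top Γ.
  refine (comp_rec (f1 := fun _ _ r => 1 - r) (comp_const _ 0) _ c1 _).
    by apply: comp_sub; [exact: comp_const | exact: comp_top].
  by move=> w; elim: w.1 => [|n] //= ->; case: odd.
by move=> w; elim: (a w) => [|n] //= ->; rewrite uphalf_half.
Qed.

Lemma compP_ext P Q : compP Γ P -> (forall w, P w <-> Q w) -> compP Γ Q.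
Proof. by move=> cP PQ; apply: (comp_ext cP) => w; rewrite (asbool_equiv_eq (PQ w)). Qed.

Lemma compP_eq0 a : comp Γ a -> compP Γ (fun w => a w = 0).
Proof.
move=> ca; apply: (comp_ext (comp_sub (comp_const _ 1) ca)) => w.
by case: asboolP; case: (a w).
Qed.

Lemma compP_leq a b : comp Γ a -> comp Γ b -> compP Γ (fun w => a w <= b w).
Proof.
move=> ca cb; apply: (compP_ext (compP_eq0 (comp_sub ca cb))) => w.
by rewrite -subn_eq0; split => /eqP.
Qed.

Lemma compP_not P : compP Γ P -> compP Γ (fun w => ~ P w).
Proof.
move=> cP; apply: (comp_ext (comp_sub (comp_const _ 1) cP)) => w.
by rewrite asbool_neg; case: asbool.
Qed.

Lemma compP_and P Q : compP Γ P -> compP Γ Q -> compP Γ (fun w => P w /\ Q w).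
Proof.
move=> cP cQ; apply: (comp_ext (comp_mul cP cQ)) => w.
by rewrite asbool_and; do 2!case: asbool.
Qed.

Lemma compP_imp P Q : compP Γ P -> compP Γ Q -> compP Γ (fun w => P w -> Q w).
Proof.
move=> cP cQ; apply: (compP_ext (compP_not (compP_and cP (compP_not cQ)))) => w.
by split=> [H p|H [p]]; [apply: contrapT => q; apply: H | apply; apply: H].
Qed.

Lemma compP_or P Q : compP Γ P -> compP Γ Q -> compP Γ (fun w => P w \/ Q w).
Proof.
move=> cP cQ; apply: (compP_ext (compP_imp (compP_not cP) cQ)) => w.
by split=> [H|[]//]; case: (pselect (P w)) => p; [left | right; apply: H].
Qed.

Lemma compP_eq a b : comp Γ a -> comp Γ b -> compP Γ (fun w => a w = b w).
Proof.
move=> ca cb.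
apply: (compP_ext (compP_and (compP_leq ca cb) (compP_leq cb ca))) => w.
by split=> [[h k]|->]; [apply/eqP; rewrite eqn_leq h | rewrite leqnn].
Qed.

Lemma compP_odd a : comp Γ a -> compP Γ (fun w => odd (a w)).
Proof. by move=> /comp_odd ca; apply: comp_ext ca _ => w; rewrite asboolb. Qed.

Lemma comp_if P a b : compP Γ P -> comp Γ a -> comp Γ b ->
  comp Γ (fun w => if `[< P w >] then a w else b w).
Proof.
move=> cP ca cb; apply: (comp_ext (comp_add (comp_mul cP ca)
  (comp_mul (comp_sub (comp_const _ 1) cP) cb))) => w.
by case: asbool; rewrite ?mul1n ?mul0n ?addn0.
Qed.

(* No rule applies to the index [idx [::]], so it diverges. *)
Lemma pcomp_assert P : compP Γ P ->
  pcomp Γ (fun w => if `[< P w >] then Some 0 else None).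
Proof.
(* [comp_if] evaluates both branches, so it is used to choose between two indices; S9 then runs only
   the chosen one, on the empty argument list. *)
move=> cP; have [e He] := comp_if cP (comp_const _ (idx [:: 2; 0]))
  (comp_const _ (idx [::])).
exists (idx [:: 4; idx [:: 9; 0]; e]) => w n; split.
  move=> /kleene_inv[b /(kleene_det (He w)) <- /kleene_inv].
  move=> [e' [G' [/cons_num_inj[<- _] _]]].
  by case: asbool => /kleene_inv // ->.
move=> H; apply: S4 (He w) _; apply: S9 => //.
by case: asbool H => // -[<-]; exact: S2.
Qed.

End arithmetic2.

(** * Unbounded search and quantification over numbers *)

Section search.
Variables (W : Type) (Γ : ctx W).

(** The restart: {i}(j, m, w) is {j}(j, m + 1, w). S9 consumes the index it runs, so j is
    duplicated, and the old m is dropped. *)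
Lemma comp_search : exists i, forall j m w n,
  kleene j (num j :: num m.+1 :: vals Γ w) n ->
  kleene i (num j :: num m :: vals Γ w) n.
Proof.
pose N := size Γ; pose Δ := push tyN (push tyN Γ).
have [e1 H1] : comp Δ (fun p => p.2.1.+1) by apply/comp_succ/comp_snd.
have [e2 H2] : comp (push tyN Δ) (fun p => p.2.1) by apply: comp_snd.
have [|| e3 H3] := @kleene_sel N.+4 [:: 0, 2, 1 & iota 4 N] (idx [:: 9; N.+2]).
- by rewrite /= !inE !mem_iota iota_uniq.
- by apply/allP => k; rewrite !inE mem_iota => /or4P[/eqP->|/eqP->|/eqP->|/andP[]].
exists (idx [:: 4; idx [:: 4; e3; e2]; e1]) => j m w n H.
have := H1 (j, (m, w)); rewrite !vals_push => {}H1; apply: S4 H1 _.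
have := H2 (m.+1, (j, (m, w))); rewrite !vals_push => {}H2; apply: S4 H2 _.
rewrite H3; last by rewrite /= size_vals.
rewrite [X in kleene _ X]/= map_nth_iota; 
  last by rewrite /= size_vals /N; lia.
rewrite /= drop0 take_oversize ?size_vals//.
by apply: S9; rewrite /= ?size_vals// take_oversize ?size_vals.
Qed.

(* The loop body receives its own index as an argument and restarts itself
   through S9, so no recursion theorem is needed. *)
Lemma comp_mu (P : W -> nat -> Prop) f :
  compP (push tyN Γ) (fun p : nat * W => P p.2 p.1) ->
  (forall w, P w (f w)) -> (forall w m, m < f w -> ~ P w m) -> comp Γ f.
Proof.
move=> cP Pf minf; pose N := size Γ; pose Δ := push tyN (push tyN Γ).
have [ir Hir] : comp Δ (fun p => p.2.1) by apply: comp_snd.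
have [is_ His] := comp_search.
have [ej Hej] : comp Δ (fun p => if `[< P p.2.2 p.2.1 >] then ir else is_).
  by apply: comp_if; [exact: comp_push cP | exact: comp_const..].
pose e := idx [:: 4; idx [:: 9; N.+2]; ej].
exists (idx [:: 4; idx [:: 4; e; idx [:: 2; e]]; idx [:: 2; 0]]) => w.
apply: S4; first exact: S2.
apply: S4; first exact: S2.
suff H d m : f w = m + d -> kleene e (num e :: num m :: vals Γ w) (f w).
  exact: H.
elim: d m => [|d IH] m fE; have := Hej (e, (m, w)); rewrite !vals_push => H;
  apply: S4 H _; (apply: S9; first by rewrite /= size_vals);
  rewrite /= take_oversize ?size_vals//; case: asboolP => Pm.
- have := Hir (e, (m, w)); rewrite !vals_push.
  by rewrite fE addn0.
- by case: Pm; rewrite -[m]addn0 -fE.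
- by case: (minf w m) => //; rewrite fE addnS ltnS leq_addr.
- by apply: His; apply: IH; rewrite fE addSnnS.
Qed.

End search.

Section quantifiers.
Variables (W : Type) (Γ : ctx W).
Hypothesis hE : has Γ (fun=> @targ ty2 E2).

Lemma compP_ex (P : W -> nat -> Prop) :
  compP (push tyN Γ) (fun p : nat * W => P p.2 p.1) ->
  compP Γ (fun w => exists n, P w n).
Proof.
move=> cP.
have c : comp Γ (fun w => E2 (fun n => 1 - `[< P w n >])).
  apply: (@comp_app2 _ _ (fun=> E2) (fun w n => 1 - `[< P w n >]) hE).
  exact: comp_sub (comp_const _ 1) cP.
apply: comp_ext (comp_sub (comp_const _ 1) c) _ => w.
rewrite /E2; case: (asboolP (exists n, P w n)) => [[n Pn]|H].
  by rewrite asboolT//; exists n; rewrite asboolT.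
rewrite asboolF// => -[n]; case: asboolP => // Pn _.
by apply: H; exists n.
Qed.

Lemma compP_all (P : W -> nat -> Prop) :
  compP (push tyN Γ) (fun p : nat * W => P p.2 p.1) ->
  compP Γ (fun w => forall n, P w n).
Proof.
move=> cP.
have c := compP_not (compP_ex (P := fun w n => ~ P w n) (compP_not cP)).
apply: (compP_ext c) => w; split=> [H n|H [n]]; last exact.
by apply: contrapT => nP; apply: H; exists n.
Qed.

End quantifiers.

Section computable_functions.
Variables (W : Type) (Γ : ctx W).

Lemma comp_div2n a b : comp Γ a -> comp Γ b -> comp Γ (fun w => a w %/ 2 ^ b w).
Proof.
move=> ca cb; refine (comp_rec (f1 := fun _ _ r => r./2) ca _ cb _).
  exact/comp_half/comp_top.
by move=> w; elim: (b w) => [|n] /=; rewrite ?divn1// expnSr divnMA divn2 => ->.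
Qed.

Lemma comp1_push s (x : W -> nat -> nat) :
  comp1 Γ x -> comp1 (push s Γ) (fun p => x p.2).
Proof.
move=> [e He].
have [|| e' He'] := @kleene_sel (size Γ).+2 (0 :: iota 2 (size Γ)) e.
- by rewrite /= mem_iota iota_uniq.
- by apply/allP => i; rewrite inE mem_iota => /orP[/eqP->|/andP[]].
exists e' => -[n [t w]]; rewrite He' !vals_push/= ?size_vals//.
rewrite map_nth_iota/= ?size_vals ?subn2// drop0 take_oversize ?size_vals//.
by have := He (n, w); rewrite vals_push.
Qed.

Definition tot0 (s : ty) : tot s :=
  let: Ty l := s in
  (fix f l : arrow nat (map tot l) :=
    match l with [::] => 0 | _ :: l' => fun=> f l' end) l.

(** Weakening in a form that a tactic can apply to any [f]: substituting the default [tot0 s] for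
    the pushed variable leaves a goal over Γ, and independence of that variable holds by
    evaluation. *)
Lemma comp_pop s (f : tot s * W -> nat) :
  comp Γ (fun w => f (tot0 s, w)) -> (forall p, f (tot0 s, p.2) = f p) ->
  comp (push s Γ) f.
Proof. by move=> cf ff; apply: comp_ext (comp_push s cf) ff. Qed.

Lemma comp1_pop s (x : tot s * W -> nat -> nat) :
  comp1 Γ (fun w => x (tot0 s, w)) -> (forall p, x (tot0 s, p.2) = x p) ->
  comp1 (push s Γ) x.
Proof.
move=> /(comp1_push s) cx xx; apply: comp_ext cx _ => p.
by rewrite -[in RHS]xx.
Qed.

Lemma comp1_var (x : W -> nat -> nat) :
  has Γ (fun w => @targ ty1 (x w)) -> comp1 Γ x.
Proof.
move=> hx; apply: (@comp_app1 _ _ (fun p => x p.2) fst); last exact: comp_top.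
exact: (has_push tyN hx).
Qed.

End computable_functions.

Definition least (P : nat -> Prop) : nat :=
  match pselect (exists n, `[< P n >]) with
  | left h => ex_minn h
  | right _ => 0
  end.

Lemma leastP P : (exists n, P n) ->
  P (least P) /\ forall m, P m -> least P <= m.
Proof.
move=> [n Pn]; rewrite /least; case: pselect => [h|[]]; last first.
  by exists n; rewrite asboolT.
by case: ex_minnP => m /asboolP Pm H; split=> // k Pk; apply: H; rewrite asboolT.
Qed.

Lemma least0 P : ~ (exists n, P n) -> least P = 0.
Proof.
move=> nP; rewrite /least; case: pselect => // h; case: nP.
by have [n /asboolP Pn] := h; exists n.
Qed.

Lemma eq_least P Q : (forall n, P n <-> Q n) -> least P = least Q.
Proof. by move=> PQ; congr least; apply/funext => n; apply/propext. Qed.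

Lemma comp_least W (Γ : ctx W) (P : W -> nat -> Prop) :
  has Γ (fun=> @targ ty2 E2) ->
  compP (push tyN Γ) (fun p : nat * W => P p.2 p.1) ->
  comp Γ (fun w => least (P w)).
Proof.
move=> hE cP; have cex := compP_ex hE cP.
(* The search must terminate even without a witness, so 0, the default of [least], is then accepted;
   E2 decides which case holds. *)
pose Q w n := P w n \/ ~ (exists m, P w m) /\ n = 0.
apply: (comp_mu (P := Q)).
- apply: compP_or => //; apply: compP_and; last first.
    by apply: compP_eq; [exact: comp_top | exact: comp_const].
  exact: comp_push (compP_not cex).
- move=> w; rewrite /Q; have [exP|nP] := pselect (exists n, P w n).
    by left; have [] := leastP exP.
  by right; rewrite least0.
- move=> w m lt [Pm|[nP m0]].
    have exP : exists n, P w n by exists m.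
    by have [_ /(_ _ Pm)] := leastP exP; rewrite leqNgt lt.
  by move: lt; rewrite least0.
Qed.

(* Ltac has no second-order patterns for the branches of an [if]. *)
Definition ite (P : Prop) (a b : nat) : nat := if `[< P >] then a else b.

Lemma has_push_cst W (Γ : ctx W) s a :
  has Γ (fun=> a) -> has (push s Γ) (fun=> a).
Proof. exact: has_push. Qed.

Ltac solve_has :=
  first [ assumption
        | lazymatch goal with |- has (push ?s ?G) (fun _ => ?a) =>
            refine (@has_push_cst _ G s a _); solve_has end
        | exists 0; reflexivity | exists 1; reflexivity | exists 2; reflexivity
        | exists 3; reflexivity | exists 4; reflexivity | exists 5; reflexivity
        | exists 6; reflexivity | exists 7; reflexivity | exists 8; reflexivity
        | exists 9; reflexivity | exists 10; reflexivity ].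

Ltac comp_leaf :=
  first [ assumption
        | solve [apply: comp_num; solve_has]
        | lazymatch goal with |- comp (push ?s ?G) ?f =>
            refine (@comp_pop _ G s f _ _);
            [cbn [fst snd]; comp_leaf | by case] end ].

Ltac comp1_leaf :=
  first [ assumption
        | solve [apply: comp1_var; solve_has]
        | lazymatch goal with |- comp1 (push ?s ?G) ?x =>
            refine (@comp1_pop _ G s x _ _);
            [cbn [fst snd]; comp1_leaf | by case] end ].

(* An Ltac pattern cannot split an application under a binder, so the body is
   inspected after opening the binder. *)
Ltac comp_apply :=
  lazymatch goal with |- @comp ?W ?G ?f =>
    let r := constr:(fun w : W => ltac:(
      let b := eval cbv beta in (f w) in
      lazymatch b with ?x ?t => exact (x, t) end)) in
    let x := eval cbn [fst] in (fun w : W => fst (r w)) in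
    let t := eval cbn [snd] in (fun w : W => snd (r w)) in
    apply: (@comp_let1 W G t x); [ | solve [comp1_leaf] ]
  end.

Ltac comp_step :=
  cbv beta;
  lazymatch goal with
  | |- comp _ (fun _ => ?c) => exact: comp_const
  | |- comp _ (fun w => S (@?a w)) => apply: (@comp_succ _ _ a)
  | |- comp _ (fun w => addn (@?a w) (@?b w)) => apply: (@comp_add _ _ a b)
  | |- comp _ (fun w => subn (@?a w) (@?b w)) => apply: (@comp_sub _ _ a b)
  | |- comp _ (fun w => muln (@?a w) (@?b w)) => apply: (@comp_mul _ _ a b)
  | |- comp _ (fun w => expn (@?a w) (@?b w)) => apply: (@comp_exp _ _ a b)
  | |- comp _ (fun w => half (@?a w)) => apply: (@comp_half _ _ a)
  | |- comp _ (fun w => divn (@?a w) (expn 2 (@?b w))) =>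
      apply: (@comp_div2n _ _ a b)
  | |- comp _ (fun w => nat_of_bool (odd (@?a w))) => apply: (@comp_odd _ _ a)
  | |- comp _ (fun w => ite (@?P w) (@?a w) (@?b w)) =>
      apply: (@comp_if _ _ P a b)
  | |- compP _ (fun w => and (@?P w) (@?Q w)) => apply: (@compP_and _ _ P Q)
  | |- compP _ (fun w => or (@?P w) (@?Q w)) => apply: (@compP_or _ _ P Q)
  | |- compP _ (fun w => not (@?P w)) => apply: (@compP_not _ _ P)
  | |- compP _ (fun w => (@?P w) -> (@?Q w)) => apply: (@compP_imp _ _ P Q)
  | |- compP _ (fun w => forall n : nat, @?P w n) =>
      apply: (@compP_all _ _ _ P); [solve_has |]
  | |- compP _ (fun w => exists n : nat, @?P w n) =>
      apply: (@compP_ex _ _ _ P); [solve_has |]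
  | |- compP _ (fun w => is_true (leq (@?a w) (@?b w))) =>
      apply: (@compP_leq _ _ a b)
  | |- compP _ (fun w => is_true (odd (@?a w))) => apply: (@compP_odd _ _ a)
  | |- compP _ (fun w => (@?a w) = (@?b w)) => apply: (@compP_eq _ _ a b)
  | |- _ => first [ comp_leaf | comp_apply ]
  end.
Ltac comp_tac := repeat comp_step.

(** * Arithmetical predicates on names of reals *)

(** [npos c] and [nneg c] are the positive and negative parts of [int_of_code c]; with them,
    inequalities between dyadics become inequalities between naturals, negative terms changing
    sides. *)
Definition npos (c : nat) : nat := (1 - odd c) * c./2.
Definition nneg (c : nat) : nat := odd c * c./2.+1.

(** The inequality |a - b| <= 2^-m between nonnegative reals, multiplied by 2^(n + m). The 2 is the
    sum of the two rounding errors; as n grows it becomes negligible, so the condition is exact.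
    [name_geD] and [name_geB] treat a + 2^-k <= b and a - 2^-k <= b in the same way. *)
Definition near (x y : nat -> nat) (m : nat) : Prop := forall n,
  npos (x n) * 2 ^ m <= (npos (y n) + 2) * 2 ^ m + 2 ^ n /\
  npos (y n) * 2 ^ m <= (npos (x n) + 2) * 2 ^ m + 2 ^ n.

Definition name_geD (x y : nat -> nat) (k : nat) : Prop := forall n,
  (npos (x n) + nneg (y n)) * 2 ^ k + 2 ^ n <=
  (npos (y n) + nneg (x n) + 2) * 2 ^ k.

Definition name_geB (x y : nat -> nat) (k : nat) : Prop := forall n,
  (npos (x n) + nneg (y n)) * 2 ^ k <=
  (npos (y n) + nneg (x n) + 2) * 2 ^ k + 2 ^ n.

Definition name_unit (x : nat -> nat) : Prop := forall n,
  nneg (x n) <= 1 /\ npos (x n) <= 2 ^ n + 1.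

(** Any two of the intervals with centre x n / 2^n and radius 2^-n meet, denominators cleared. On
    the line this yields a point common to all of them. *)
Definition is_name (x : nat -> nat) : Prop := forall n m,
  npos (x n) * 2 ^ m + nneg (x m) * 2 ^ n <=
  npos (x m) * 2 ^ n + nneg (x n) * 2 ^ m + 2 ^ n + 2 ^ m.

(** A sequence that names nothing becomes a name of 0. This makes M converge on every sequence, so
    that the radius handed to Delta is total, as S8 demands. *)
Definition to_name (x : nat -> nat) (n : nat) : nat :=
  ite (is_name x) (x n) 0.

Definition dyadic_name (j i n : nat) : nat := 2 * (j * 2 ^ n %/ 2 ^ i).

(** The integer written in base q with the first n digits z_i + d. The case (2, 0) gives binary
    expansions, which exhaust [0, 1]; (4, 1) gives the embedding. *)
Fixpoint expansion (q d : nat) (z : nat -> nat) (n : nat) : nat :=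
  if n is n'.+1 then q * expansion q d z n' + d + z n' else 0.

Definition bin_name (z : nat -> nat) (n : nat) : nat := 2 * expansion 2 0 z n.

(** The numerator over 4^n is divided by 2^n to become a numerator over 2^n; the factor 2 makes it
    the code of a natural. *)
Definition quat_name (z : nat -> nat) (n : nat) : nat :=
  2 * (expansion 4 1 z n %/ 2 ^ n).

Section names.
Variables (W : Type) (Γ : ctx W).
Hypothesis hE : has Γ (fun=> @targ ty2 E2).
Variables (x y z : W -> nat -> nat) (i j k : W -> nat).
Hypotheses (cx : comp1 Γ x) (cy : comp1 Γ y) (cz : comp1 Γ z).
Hypotheses (ci : comp Γ i) (cj : comp Γ j) (ck : comp Γ k).

Lemma compP_near : compP Γ (fun w => near (x w) (y w) (k w)).
Proof. rewrite /near /npos; comp_tac. Qed.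

Lemma compP_name_geD : compP Γ (fun w => name_geD (x w) (y w) (k w)).
Proof. by rewrite /name_geD /npos /nneg; comp_tac. Qed.

Lemma compP_name_geB : compP Γ (fun w => name_geB (x w) (y w) (k w)).
Proof. by rewrite /name_geB /npos /nneg; comp_tac. Qed.

Lemma compP_name_unit : compP Γ (fun w => name_unit (x w)).
Proof. by rewrite /name_unit /npos /nneg; comp_tac. Qed.

Lemma comp1_dyadic_name : comp1 Γ (fun w => dyadic_name (j w) (i w)).
Proof. by rewrite /comp1 /dyadic_name; comp_tac. Qed.

Lemma comp1_expansion q d : comp1 Γ (fun w => expansion q d (z w)).
Proof.
refine (comp_rec (f0 := fun=> 0) (f1 := fun p n r => q * r + d + z p.2 n) _ _
  (comp_top _) _).
- comp_tac.
- by comp_tac.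
- by move=> p; elim: p.1 => //= n ->.
Qed.

End names.

Section names2.
Variables (W : Type) (Γ : ctx W).
Hypothesis hE : has Γ (fun=> @targ ty2 E2).
Variables (x z : W -> nat -> nat).
Hypotheses (cx : comp1 Γ x) (cz : comp1 Γ z).

Lemma compP_is_name : compP Γ (fun w => is_name (x w)).
Proof.
rewrite /is_name /npos /nneg; comp_tac.
Qed.

Lemma comp1_bin_name : comp1 Γ (fun w => bin_name (z w)).
Proof.
by have := comp1_expansion cz; rewrite /comp1 /bin_name => c; comp_tac.
Qed.

Lemma comp1_quat_name : comp1 Γ (fun w => quat_name (z w)).
Proof.
by have := comp1_expansion cz; rewrite /comp1 /quat_name => c; comp_tac.
Qed.

End names2.

Lemma comp1_to_name W (Γ : ctx W) x : has Γ (fun=> @targ ty2 E2) ->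
  comp1 Γ x -> comp1 Γ (fun w => to_name (x w)).
Proof.
move=> hE cx; have := comp_push tyN (compP_is_name hE cx).
rewrite /comp1 /to_name => c; comp_tac.
Qed.

(** * The programs *)

Lemma acomps_consN W (Γ : ctx W) l g (gs : W -> tup l) :
  comp Γ g -> acomps Γ gs -> @acomps (tyN :: l) W Γ (fun w => (g w, gs w)).
Proof. by move=> cg; apply: (@acomps_cons _ _ [::]); apply: acomp0. Qed.

Lemma acomps_cons1 W (Γ : ctx W) l (g : W -> nat -> nat) (gs : W -> tup l) :
  comp1 Γ g -> acomps Γ gs -> @acomps (ty1 :: l) W Γ (fun w => (g w, gs w)).
Proof. by move=> cg; apply: (@acomps_cons _ _ [:: tyN]); apply: acomp1. Qed.

Lemma acomps_cons2 W (Γ : ctx W) l (g : W -> tot ty2) (gs : W -> tup l) :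
  comp (push ty1 Γ) (fun p => g p.2 p.1) -> acomps Γ gs ->
  @acomps (ty2 :: l) W Γ (fun w => (g w, gs w)).
Proof. by move=> cg; apply: (@acomps_cons _ _ [:: ty1]); apply: acomp1. Qed.

Lemma acomps_cons11 W (Γ : ctx W) l (g : W -> tot ty11) (gs : W -> tup l) :
  comp (push ty1 (push tyN Γ)) (fun p => g p.2.2 p.1 p.2.1) -> acomps Γ gs ->
  @acomps (ty11 :: l) W Γ (fun w => (g w, gs w)).
Proof. by move=> cg; apply: (@acomps_cons _ _ [:: ty1; tyN]); apply: acomp2. Qed.

(* If x names the image a of z and x (2 n + 2) codes c, then c / 4 is within 1/4
   of a 4^n, whose fractional part lies in [1/3, 2/3]; so c %/ 4 is the integer
   coded by the first n base-4 digits of a.  As codes of naturals are doubled,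
   this is x (2 n + 2) %/ 8.  The digits are z_i + 1, hence the parity test. *)
Definition digits (x : nat -> nat) (i : nat) : nat :=
  1 - odd (x (2 * i + 4) %/ 2 ^ 3).

Definition prefix (x : nat -> nat) (n : nat) : nat := x (2 * n + 2) %/ 2 ^ 3.

(** Even codes are those of nonnegative entries, the only ones from which [prefix] can be read; the
    recursion then says that every digit is 1 or 2. *)
Definition in_range (x : nat -> nat) : Prop :=
  prefix x 0 = 0 /\ forall n, ~ odd (x (2 * n + 2)) /\
    (prefix x n.+1 = 4 * prefix x n + 1 \/ prefix x n.+1 = 4 * prefix x n + 2).

Definition in_image (X : tot ty2) (x : nat -> nat) : Prop :=
  in_range x /\ X (digits x) = 1.

Definition ind_name (X : tot ty2) (x : nat -> nat) (n : nat) : nat :=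
  ite (in_image X x) (2 ^ n.+1) 0.

(* The minimum of a and 1 - a, in truncated arithmetic. *)
Definition gap (x : nat -> nat) (n : nat) : nat :=
  npos (x n) - (npos (x n) - (2 ^ n - npos (x n))).

(** A gap of two units exceeds the rounding error of one unit, so it certifies 0 < a < 1
    strictly. *)
Definition in_compl (X : tot ty2) (x : nat -> nat) : Prop :=
  (exists n, 2 <= gap x n) /\ ~ in_image X x.

Definition compl_char (X : tot ty2) (x : nat -> nat) : nat :=
  ite (in_compl X x) 1 0.

(** The nested truncated subtractions are the minimum of [gap x n] and the n-th numerator of 2^-(r
    x). *)
Definition radius_name (X : tot ty2) (r : (nat -> nat) -> nat) (x : nat -> nat)
    (n : nat) : nat :=
  ite (in_compl X x)
    (2 * (gap x n - (gap x n - 2 ^ n %/ 2 ^ r x))) 0.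

(* One sequence u stands for the pair of points (evens u, odds u). *)
Definition evens (u : nat -> nat) (i : nat) : nat := odd (u (2 * i)).
Definition odds (u : nat -> nat) (i : nat) : nat := odd (u (2 * i + 1)).

Definition check_prop (X : tot ty2) (N : nat) (u : nat -> nat) : Prop :=
  X (evens u) <= 1 /\
  (X (evens u) = 0 -> (forall i, i.+1 <= N -> evens u i = odds u i) ->
   X (odds u) = 0).

Section omega.
Variables (W : Type) (Γ : ctx W) (X : W -> tot ty2) (x : W -> nat -> nat).
Hypothesis hE : has Γ (fun=> @targ ty2 E2).
Hypothesis hX : has Γ (fun w => targ (X w)).
Hypothesis cx : comp1 Γ x.

Lemma compP_in_image : compP Γ (fun w => in_image (X w) (x w)).
Proof.
have c : comp Γ (fun w => X w (digits (x w))).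
  by apply: comp_app2 => //; rewrite /comp1 /digits; comp_tac.
by rewrite /in_image /in_range /prefix; comp_tac.
Qed.

Lemma compP_in_compl : compP Γ (fun w => in_compl (X w) (x w)).
Proof.
by have := compP_in_image; rewrite /in_compl /gap /npos => c; comp_tac.
Qed.

Lemma comp_compl_char : comp Γ (fun w => compl_char (X w) (x w)).
Proof. by have := compP_in_compl; rewrite /compl_char => c; comp_tac. Qed.

Lemma comp_ind_name n : comp Γ n -> comp Γ (fun w => ind_name (X w) (x w) (n w)).
Proof. by have := compP_in_image; rewrite /ind_name => c cn; comp_tac. Qed.

Lemma comp_radius_name (r : W -> (nat -> nat) -> nat) n :
  comp Γ (fun w => r w (x w)) ->
  comp Γ n -> comp Γ (fun w => radius_name (X w) (r w) (x w) (n w)).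
Proof.
by have := compP_in_compl; rewrite /radius_name /gap /npos => c cr cn; comp_tac.
Qed.

Lemma compP_check N : comp Γ N ->
  compP Γ (fun w => check_prop (X w) (N w) (x w)).
Proof.
move=> cN; have [ce co] : comp1 Γ (fun w => evens (x w)) /\
    comp1 Γ (fun w => odds (x w)).
  by split; rewrite /comp1 /evens /odds; comp_tac.
have cXe := comp_app2 hX ce; have cXo := comp_app2 hX co.
by rewrite /check_prop; comp_tac.
Qed.

End omega.

Lemma pcomp_Musco W (Γ : ctx W) (M : part ty_Musco) (f : W -> tot ty11)
    (y : W -> nat -> nat) (k : W -> nat) : has Γ (fun=> @parg ty_Musco M) ->
  comp (push ty1 (push tyN Γ)) (fun p => f p.2.2 p.1 p.2.1) ->
  comp1 Γ y -> comp Γ k -> pcomp Γ (fun w => M (f w) (y w) (k w)).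
Proof.
move=> hM cf cy ck.
apply: (@pcomp_app _ _ [:: ty11; ty1; tyN] (fun=> M)
  (fun w => (f w, (y w, (k w, tt)))) hM).
apply: acomps_cons11 => //; apply: acomps_cons1 => //.
by apply: acomps_consN => //; apply: acomps_nil.
Qed.

Lemma pcomp_Omega W (Γ : ctx W) (X : W -> tot ty2) :
  has Γ (fun=> @parg (Ty [:: ty2]) Omega_C) ->
  comp (push ty1 Γ) (fun p => X p.2 p.1) ->
  pcomp Γ (fun w => Omega_C (X w)).
Proof.
move=> hO cX; apply: (@pcomp_app _ _ [:: ty2] (fun=> Omega_C) (fun w => (X w, tt)) hO).
by apply: acomps_cons2 => //; apply: acomps_nil.
Qed.

(* For d 0 n and d 1 n names of a_n and b_n: each of the 2^(L+1) cells of length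
   2^-L / 4 of [1/4, 3/4] is contained in some ]a_n, b_n[, with m witnessing the
   strict inequalities. *)
Definition covers (d : nat -> nat -> nat -> nat) : Prop :=
  exists L, forall j, j.+1 <= 2 * 2 ^ L -> exists n m,
    (npos (d 0 n m) + 1) * (4 * 2 ^ L) + 1 <= (2 ^ L + j) * 2 ^ m /\
    (2 ^ L + j + 1) * 2 ^ m + 4 * 2 ^ L + 1 <= npos (d 1 n m) * (4 * 2 ^ L).

Lemma pcomp_ind_Musco W (Γ : ctx W) (X : W -> tot ty2) (M : part ty_Musco)
    (y : W -> nat -> nat) :
  has Γ (fun=> @targ ty2 E2) -> has Γ (fun w => targ (X w)) ->
  has Γ (fun=> @parg ty_Musco M) -> comp1 Γ y ->
  pcomp Γ (fun w => M (ind_name (X w)) (y w) 0).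
Proof.
move=> hE hX hM cy; apply: pcomp_Musco => //; last exact: comp_const.
apply: (@comp_ind_name _ _ (fun p => X p.2.2) fst _ _ _ (fun p => p.2.1)).
- solve_has.
- exact: (has_push ty1 (has_push tyN hX)).
- by apply: comp1_var; solve_has.
- by comp_tac.
Qed.

Lemma comp_radius W (Γ : ctx W) (X : W -> tot ty2) (M : part ty_Musco)
    (r : W -> (nat -> nat) -> nat) (x : W -> nat -> nat) :
  has Γ (fun=> @targ ty2 E2) -> has Γ (fun w => targ (X w)) ->
  has Γ (fun=> @parg ty_Musco M) ->
  (forall w x, M (ind_name (X w)) (to_name x) 0 = Some (r w x)) ->
  comp1 Γ x -> comp Γ (fun w => r w (x w)).
Proof.
move=> hE hX hM Mr cx.
by apply: pcomp_comp (pcomp_ind_Musco hE hX hM (comp1_to_name hE cx)) _.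
Qed.

Lemma comp_Delta W (Γ : ctx W) (X : W -> tot ty2) (M : part ty_Musco)
    (Delta : part ty_Delta)
    (r : W -> (nat -> nat) -> nat) (d : W -> nat -> nat -> nat -> nat) s n m :
  has Γ (fun=> @targ ty2 E2) -> has Γ (fun w => targ (X w)) ->
  has Γ (fun=> @parg ty_Musco M) -> has Γ (fun=> @parg ty_Delta Delta) ->
  (forall w x, M (ind_name (X w)) (to_name x) 0 = Some (r w x)) ->
  (forall w, Delta (compl_char (X w)) (radius_name (X w) (r w)) E2
     (s w) (n w) (m w) = Some (d w (s w) (n w) (m w))) ->
  comp Γ s -> comp Γ n -> comp Γ m -> comp Γ (fun w => d w (s w) (n w) (m w)).
Proof.
move=> hE hX hM hD Mr Dd cs cn cm.
pose gs w : tup [:: ty2; ty11; ty2; tyN; tyN; tyN] :=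
  (compl_char (X w), (radius_name (X w) (r w), (E2, (s w, (n w, (m w, tt)))))).
have : acomps Γ gs; last first.
  move=> /(@pcomp_app _ _ [:: ty2; ty11; ty2; tyN; tyN; tyN] (fun=> Delta) gs hD).
  by move=> c; apply: pcomp_comp c _ => w; exact: Dd.
apply: acomps_cons2.
  apply: (@comp_compl_char _ _ (fun p => X p.2) fst) => //.
  - solve_has.
  - exact: (has_push ty1 hX).
  - by apply: comp1_var; solve_has.
apply: acomps_cons11.
  apply: (@comp_radius_name _ _ (fun p => X p.2.2) fst _ _ _
    (fun p => r p.2.2) (fun p => p.2.1)).
  - solve_has.
  - exact: (has_push ty1 (has_push tyN hX)).
  - by apply: comp1_var; solve_has.
  - apply: (@comp_radius _ _ (fun p => X p.2.2) M (fun p => r p.2.2) fst).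
    + solve_has.
    + exact: (has_push ty1 (has_push tyN hX)).
    + solve_has.
    + by move=> w x; apply: Mr.
    + by apply: comp1_var; solve_has.
  - by comp_tac.
apply: (@acomps_cons2 _ _ _ (fun=> E2)).
  apply: (@comp_app2 _ _ (fun=> E2) fst); first solve_has.
  by apply: comp1_var; solve_has.
by do 3!apply: acomps_consN => //; apply: acomps_nil.
Qed.

Lemma compP_covers W (Γ : ctx W) (X : W -> tot ty2) (M : part ty_Musco)
    (Delta : part ty_Delta)
    (r : W -> (nat -> nat) -> nat) (d : W -> nat -> nat -> nat -> nat) :
  has Γ (fun=> @targ ty2 E2) -> has Γ (fun w => targ (X w)) ->
  has Γ (fun=> @parg ty_Musco M) -> has Γ (fun=> @parg ty_Delta Delta) ->
  (forall w x, M (ind_name (X w)) (to_name x) 0 = Some (r w x)) ->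
  (forall w s n m, s <= 1 ->
    Delta (compl_char (X w)) (radius_name (X w) (r w)) E2 s n m =
    Some (d w s n m)) ->
  compP Γ (fun w => covers (d w)).
Proof.
move=> hE hX hM hD Mr Dd.
pose Δ := push tyN (push tyN (push tyN (push tyN Γ))).
have c s : s <= 1 -> comp Δ (fun p => d p.2.2.2.2 s p.2.1 p.1).
  move=> s1.
  have hX' := has_push tyN (has_push tyN (has_push tyN (has_push tyN hX))).
  apply: (@comp_Delta _ Δ (fun p => X p.2.2.2.2) M Delta
    (fun p => r p.2.2.2.2) (fun p => d p.2.2.2.2) (fun=> s)
    (fun p => p.2.1) fst) => //; try (by rewrite /Δ; solve_has);
    [by move=> p; apply: Dd | by rewrite /Δ; comp_tac..].
have c0 := c 0 isT; have c1 := c 1 isT; move: c0 c1; rewrite /Δ => c0 c1.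
by rewrite /covers /npos; comp_tac.
Qed.

(** * Programs that call Omega_C *)

(** [name_unit x] empties the set when x names a point outside [0, 1], where [fh] is unconstrained;
    thus the set is closed, and [Omega_C] defined, for every name x. *)
Definition upper_char (fh : tot ty11) (x : nat -> nat) (k m : nat)
    (z : nat -> nat) : nat :=
  ite (name_unit x /\ near x (bin_name z) m /\
       name_geD (fh x) (fh (bin_name z)) k) 1 0.

(** The lower half is a weak inequality with [k.+1], which implies the strict one with k. *)
Definition modulus_prop (fh : tot ty11) (x : nat -> nat) (k m : nat) : Prop :=
  name_unit x /\ Omega_C (upper_char fh x k m) = Some 0 /\
  forall i j, j <= 2 ^ i -> near x (dyadic_name j i) m ->
    name_geB (fh x) (fh (dyadic_name j i)) k.+1.

Lemma comp_upper_char W (Γ : ctx W) (fh : W -> tot ty11)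
    (x z : W -> nat -> nat) (k m : W -> nat) :
  has Γ (fun=> @targ ty2 E2) -> has Γ (fun w => targ (fh w)) ->
  comp1 Γ x -> comp1 Γ z -> comp Γ k -> comp Γ m ->
  comp Γ (fun w => upper_char (fh w) (x w) (k w) (m w) (z w)).
Proof.
move=> hE hf cx cz ck cm; have cb := comp1_bin_name cz.
have fE y : comp1 Γ y -> comp1 Γ (fun w => fh w (y w)).
  move=> cy; apply: (@comp_app11 _ _ (fun p => fh p.2) (fun p => y p.2) fst).
  - exact: (has_push tyN hf).
  - exact: (comp1_push tyN cy).
  - exact: comp_top.
have c1 := compP_name_unit hE cx.
have c2 := compP_near hE cx cb cm.
have c3 := compP_name_geD hE (fE _ cx) (fE _ cb) ck.
by rewrite /upper_char; comp_tac.
Qed.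

Lemma comp_modulus W (Γ : ctx W) (fh : W -> tot ty11)
    (x : W -> nat -> nat) (k : W -> nat) (o : W -> nat -> nat) :
  has Γ (fun=> @targ ty2 E2) -> has Γ (fun=> @parg (Ty [:: ty2]) Omega_C) ->
  has Γ (fun w => targ (fh w)) -> comp1 Γ x -> comp Γ k ->
  (forall w m, Omega_C (upper_char (fh w) (x w) (k w) m) = Some (o w m)) ->
  comp Γ (fun w => least (modulus_prop (fh w) (x w) (k w))).
Proof.
move=> hE hO hf cx ck Oo.
apply: (@comp_least _ _ (fun w => modulus_prop (fh w) (x w) (k w))) => //.
have hE1 : has (push tyN Γ) (fun=> @targ ty2 E2) by solve_has.
have hO1 : has (push tyN Γ) (fun=> @parg (Ty [:: ty2]) Omega_C).
  solve_has.
have hf1 := has_push tyN hf; have ck1 := comp_push tyN ck.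
have cx1 := comp1_push tyN cx.
have co : comp (push tyN Γ) (fun p => o p.2 p.1).
  apply: pcomp_comp (pcomp_Omega
    (X := fun p => upper_char (fh p.2) (x p.2) (k p.2) p.1) hO1 _) _ => //.
  apply: (@comp_upper_char _ _ (fun p => fh p.2.2) (fun p => x p.2.2) fst
    (fun p => k p.2.2) (fun p => p.2.1)).
  - solve_has.
  - exact: (has_push ty1 hf1).
  - exact: (comp1_push ty1 cx1).
  - by apply: comp1_var; solve_has.
  - exact: (comp_push ty1 ck1).
  - by comp_tac.
have co1 := compP_eq0 co.
have c1 := compP_name_unit hE1 cx1.
pose Δ := push tyN (push tyN (push tyN Γ)).
have hEΔ : has Δ (fun=> @targ ty2 E2) by rewrite /Δ; solve_has.
have cxΔ := comp1_push tyN (comp1_push tyN cx1).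
have cd : comp1 Δ (fun p => dyadic_name p.1 p.2.1).
  by apply: comp1_dyadic_name; rewrite /Δ; comp_tac.
have c2 : compP Δ (fun p => near (x p.2.2.2) (dyadic_name p.1 p.2.1) p.2.2.1).
  by apply: compP_near => //; rewrite /Δ; comp_tac.
have c3 : compP Δ (fun p => name_geB (fh p.2.2.2 (x p.2.2.2))
    (fh p.2.2.2 (dyadic_name p.1 p.2.1)) (k p.2.2.2).+1).
  have hfΔ := has_push tyN (has_push tyN (has_push tyN (hf1))).
  apply: compP_name_geB => //.
  - apply: (@comp_app11 _ _ (fun p => fh p.2.2.2.2) (fun p => x p.2.2.2.2) fst).
    + exact: hfΔ.
    + exact: (comp1_push tyN cxΔ).
    + exact: comp_top.
  - apply: (@comp_app11 _ _ (fun p => fh p.2.2.2.2)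
      (fun p => dyadic_name p.2.1 p.2.2.1) fst).
    + exact: hfΔ.
    + exact: (comp1_push tyN cd).
    + exact: comp_top.
  - by rewrite /Δ; comp_tac.
apply: (@compP_ext _ _ (fun p => name_unit (x p.2) /\ o p.2 p.1 = 0 /\
  forall i j, j <= 2 ^ i -> near (x p.2) (dyadic_name j i) p.1 ->
    name_geB (fh p.2 (x p.2)) (fh p.2 (dyadic_name j i)) (k p.2).+1)).
  by rewrite /Δ in c2 c3; comp_tac.
by move=> p; rewrite /modulus_prop Oo; split=> -[? [E ?]]; split=> //; split=> //;
  [rewrite E | case: E].
Qed.

(* n = 2^i + j with j < 2^i stands for the interval ]j / 2^i, (j + 2) / 2^i[. *)
Definition level (n : nat) : nat := least (fun i => n.+1 <= 2 ^ i.+1).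
Definition offset (n : nat) : nat := n - 2 ^ level n.

Definition outside_char (Oh : tot ty2) (n : nat) (z : nat -> nat) : nat :=
  ite (near (dyadic_name (offset n + 1) (level n)) (bin_name z) (level n) /\
       ~ Oh (bin_name z) = 1) 1 0.

(** A rejected cell gets both endpoints 0 and contributes the empty interval. *)
Definition endpoint_name (Oh : tot ty2) (s n : nat) : nat -> nat := fun m =>
  ite (Omega_C (outside_char Oh n) = Some 0)
    (dyadic_name (offset n + 2 * s) (level n) m) 0.

Lemma comp_level W (Γ : ctx W) n : has Γ (fun=> @targ ty2 E2) -> comp Γ n ->
  comp Γ (fun w => level (n w)).
Proof. by move=> hE cn; apply: comp_least => //; comp_tac. Qed.

Lemma comp_endpoint_name W (Γ : ctx W) (Oh : W -> tot ty2) (s n m o : W -> nat) :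
  has Γ (fun=> @targ ty2 E2) -> has Γ (fun=> @parg (Ty [:: ty2]) Omega_C) ->
  has Γ (fun w => targ (Oh w)) -> comp Γ s -> comp Γ n -> comp Γ m ->
  (forall w, Omega_C (outside_char (Oh w) (n w)) = Some (o w)) ->
  comp Γ (fun w => endpoint_name (Oh w) (s w) (n w) (m w)).
Proof.
move=> hE hO hOh cs cn cm Oo.
have cl := comp_level hE cn.
have cf : comp Γ (fun w => offset (n w)) by rewrite /offset; comp_tac.
have cz : comp1 (push ty1 Γ) fst by apply: comp1_var; solve_has.
have cb := comp1_bin_name cz.
have hE1 : has (push ty1 Γ) (fun=> @targ ty2 E2) by solve_has.
have co : comp Γ o.
  apply: pcomp_comp (pcomp_Omega
    (X := fun w => outside_char (Oh w) (n w)) hO _) _ => //.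
  have c1 : compP (push ty1 Γ) (fun p => near
      (dyadic_name (offset (n p.2) + 1) (level (n p.2))) (bin_name p.1)
      (level (n p.2))).
    have cl1 := comp_push ty1 cl; have cf1 := comp_push ty1 cf.
    by apply: compP_near => //; apply: comp1_dyadic_name => //; comp_tac.
  have c2 : comp (push ty1 Γ) (fun p => Oh p.2 (bin_name p.1)).
    by apply: (@comp_app2 _ _ (fun p => Oh p.2)) => //; exact: (has_push ty1 hOh).
  by rewrite /outside_char; comp_tac.
have co1 := compP_eq0 co.
have cd : comp Γ (fun w => dyadic_name (offset (n w) + 2 * s w) (level (n w)) (m w)).
  by rewrite /dyadic_name; comp_tac.
apply: (@comp_ext _ _ (fun w => ite (o w = 0)
  (dyadic_name (offset (n w) + 2 * s w) (level (n w)) (m w)) 0)).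
  by comp_tac.
move=> w; rewrite /endpoint_name Oo /ite; congr (if _ then _ else _).
by apply: asbool_equiv_eq; split=> [->|[]].
Qed.

Import Order.TTheory GRing.Theory Num.Theory.
Import numFieldNormedType.Exports.
Local Open Scope classical_set_scope.
Local Open Scope ring_scope.

(** * Names of reals *)

Section analysis.
Variable R : realType.
Implicit Types (a b c e : R) (f : R -> R).

Lemma exp2_gt0 n : 0 < 2 ^+ n :> R.
Proof. by rewrite exprn_gt0. Qed.

Lemma exp2_gt e : exists n, e < 2 ^+ n.
Proof.
have [e0|e0] := leP 0 e; last by exists 0; rewrite expr0; lra.
exists (Num.bound e); apply: lt_trans (archi_boundP e0) _.
by rewrite -natrX ltr_nat ltn_expl.
Qed.

Lemma exp2N_lt e : 0 < e -> exists n, 2 ^- n < e.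
Proof.
move=> e0; have [n en] := exp2_gt e^-1; exists n.
by rewrite -[e]invrK ltf_pV2// posrE ?exp2_gt0// invr_gt0.
Qed.

Lemma le_exp2 a b c : (forall n, (a - b) * 2 ^+ n <= c) -> a <= b.
Proof.
move=> H; rewrite leNgt; apply/negP => ba.
have [n Hn] := exp2_gt (c / (a - b)).
have := H n; rewrite leNgt => /negP; apply.
by rewrite mulrC -ltr_pdivrMr// subr_gt0.
Qed.

Lemma nested (l u : nat -> R) : (forall n m, l n <= u m) ->
  exists a, forall n, l n <= a <= u n.
Proof.
move=> lu; exists (sup (range l)) => n; apply/andP; split.
  by apply: ub_le_sup; [exists (u 0) => _ [m _ <-] | exists n].
by apply: ge_sup; [exists (l 0), 0%N | move=> _ [m _ <-]].
Qed.

Lemma uscoP f : usco f <-> forall x0, unitI R x0 -> forall c, f x0 < c ->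
  exists2 d, 0 < d & forall y, unitI R y -> `|y - x0| < d -> f y < c.
Proof.
split=> [uf x0 Ix0 c fc|H x0 Ix0].
  have /ereal_inf_lt[_ [V VF <-] Vc] : (limf_esup (EFin \o f)
      (within (unitI R) x0^') < c%:E)%E.
    by apply: le_lt_trans (uf _ Ix0) _; rewrite lte_fin.
  move: VF => /nbhs_ballP[d /= d0 dV]; exists d => // y Iy yx.
  (* The limsup is taken over punctured neighbourhoods; at [x0] itself the bound is the
     assumption. *)
  have [->//|yx0] := eqVneq y x0.
  rewrite -lte_fin; apply: le_lt_trans Vc; apply: ereal_sup_ubound.
  by exists y => //; apply: dV => //; rewrite /ball/= distrC.
apply/lee_addgt0Pr => e e0.
have [|d d0 Hd] := H x0 Ix0 (f x0 + e); first by rewrite ltrDl.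
apply: ge_ereal_inf.
exists (ereal_sup ((EFin \o f) @` [set y | f y < f x0 + e])).
  exists [set y | f y < f x0 + e] => //.
  apply/nbhs_ballP; exists d => // y; rewrite /ball/= => yx _ Iy.
  by apply: Hd => //; rewrite distrC.
by apply: ge_ereal_sup => _ [y /= yc <-]; rewrite lee_fin ltW.
Qed.

Lemma cont_pointP f a : cont_points f a <-> unitI R a /\ forall e, 0 < e ->
  exists2 d, 0 < d & forall y, unitI R y -> `|y - a| < d -> `|f y - f a| < e.
Proof.
split=> [[Ia fa]|[Ia H]]; split=> //.
  move=> e e0; have /= := fa [set y | `|y - f a| < e].
  case=> [|d /= d0 Hd].
    by apply/nbhs_ballP; exists e => // y; rewrite /ball/= distrC.
  by exists d => // y Iy ya; apply: Hd => //=; rewrite distrC.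
move=> U /nbhs_ballP[e /= e0 eU]; have [d d0 Hd] := H e e0.
apply/nbhs_ballP; exists d => // y; rewrite /ball/= => ya Iy.
by apply: eU; rewrite /ball/= distrC; apply: Hd; rewrite // distrC.
Qed.

End analysis.

(** * Cylinders in Cantor space *)

Definition agree (n : nat) (z z' : nat -> nat) : Prop :=
  forall i, (i < n)%N -> z i = z' i.

Lemma cylinder_nbhs (z : cantor_space) n :
  nbhs z [set z' : cantor_space | agree n (cseq z) (cseq z')].
Proof.
elim: n => [|n IH]; first by apply: filterS filterT => z' _ i.
have zn : nbhs z [set z' : cantor_space | z' n = z n].
  have := @proj_continuous nat (fun=> bool) n z [set z n].
  by apply; exact: discrete_set1.
apply: filterS (filterI IH zn) => z' [/= H zz'] i.
by rewrite ltnS leq_eqVlt => /predU1P[->|/H//]; rewrite /cseq zz'.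
Qed.

(** The product topology is a supremum of topologies, so it suffices that the filter of cylinders
    converges to z in each coordinate. *)
Lemma nbhs_cylinder (z : cantor_space) (U : set cantor_space) : nbhs z U ->
  exists n, forall z', agree n (cseq z) (cseq z') -> U z'.
Proof.
pose C n := [set z' : cantor_space | agree n (cseq z) (cseq z')].
have CF : Filter (filter_from [set: nat] C).
  apply: filter_from_filter; first by exists 0%N.
  move=> i j _ _; exists (maxn i j) => // z' H.
  by split=> k ki; apply: H; rewrite leq_max ki ?orbT.
suff H : filter_from [set: nat] C --> z by move=> /H[n _ Cn]; exists n.
apply/cvg_sup => i U' [B [[V oV <-]] Vz BU].
exists i.+1 => // z' H; apply: BU => /=.
suff -> : z' i = z i by [].
by have := H i (ltnSn i); rewrite /cseq; case: (z i); case: (z' i).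
Qed.

Lemma closed_cylinderP (C : set cantor_space) : closed C <->
  forall z, ~ C z -> exists n, forall z', agree n (cseq z) (cseq z') -> ~ C z'.
Proof.
split=> [cC z Cz|H z clz].
  by apply: (nbhs_cylinder (U := ~` C)); apply: open_nbhs_nbhs; split=> //;
    exact: closed_openC.
apply: contrapT => /H[n Hn].
by have [z' [Cz' /Hn]] := clz _ (cylinder_nbhs z n).
Qed.

Lemma npos_double k : npos (2 * k) = k.
Proof. by rewrite /npos mul2n odd_double doubleK mul1n. Qed.

Lemma nneg_double k : nneg (2 * k) = 0%N.
Proof. by rewrite /nneg mul2n odd_double. Qed.

Lemma npos_nneg c : npos c = 0%N \/ nneg c = 0%N.
Proof. by rewrite /npos /nneg; case: odd; [left | right]. Qed.

Section names_of_reals.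
Variable R : realType.
Implicit Types (a b c e : R) (x y z : nat -> nat).

Definition approx x n : R := (npos (x n))%:R - (nneg (x n))%:R.

Lemma int_of_codeE m :
  (int_of_code m)%:~R = (npos m)%:R - (nneg m)%:R :> R.
Proof.
rewrite /int_of_code /npos /nneg; case: odd => /=.
  by rewrite NegzE mulrNz subnn mul0n mul1n sub0r.
by rewrite subn0 mul0n mul1n subr0.
Qed.

Lemma real_nameP x a : real_name x a <->
  forall n, -1 <= a * 2 ^+ n - approx x n <= 1.
Proof.
have H n : (`|a - (int_of_code (x n))%:~R / 2 ^+ n| <= 2 ^- n) =
    (-1 <= a * 2 ^+ n - approx x n <= 1).
  rewrite ler_norml -(ler_pM2r (exp2_gt0 R n)).
  rewrite -[X in _ && X](ler_pM2r (exp2_gt0 R n)) mulNr mulVf ?gt_eqF ?exp2_gt0//.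
  by rewrite mulrBl divfK ?gt_eqF ?exp2_gt0// int_of_codeE.
by split=> h n; have := h n; rewrite H.
Qed.

(** Each name errs by at most one unit, which gives the 2; conversely (a + c - b) 2^n <= 4 for all n
    forces a + c <= b. *)
Lemma real_name_le x y a b c : real_name x a -> real_name y b ->
  (forall n, approx x n + c * 2 ^+ n <= approx y n + 2) <-> a + c <= b.
Proof.
move=> /real_nameP xa /real_nameP yb; split=> [H|H n].
  apply: (@le_exp2 _ _ _ 4) => n; rewrite mulrBl mulrDl.
  by have := xa n; have := yb n; have := H n; lra.
have : (a + c) * 2 ^+ n <= b * 2 ^+ n by rewrite ler_pM2r ?exp2_gt0.
by rewrite mulrDl; have := xa n; have := yb n; lra.
Qed.

(** Rounding negative entries up to 0 only improves them when a >= 0. This is why [near] and [gap]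
    may read [npos] alone. *)
Lemma real_name_npos x a : 0 <= a -> real_name x a ->
  real_name (fun n => (2 * npos (x n))%N) a.
Proof.
move=> a0 /real_nameP xa; apply/real_nameP => n; have := xa n.
rewrite /approx npos_double nneg_double subr0.
have : 0 <= a * 2 ^+ n by rewrite mulr_ge0// ltW ?exp2_gt0.
case: (npos_nneg (x n)) => ->; last by rewrite subr0.
by have := ler0n R (nneg (x n)); lra.
Qed.

Lemma scaled_leD p q k n :
  (p * 2 ^ k + 2 ^ n <= q * 2 ^ k)%N = (p%:R + 2 ^- k * 2 ^+ n <= q%:R :> R).
Proof.
rewrite -(ler_nat R) natrD !natrM !natrX -[RHS](ler_pM2r (exp2_gt0 R k)) mulrDl.
by rewrite mulrAC mulVf ?gt_eqF ?exp2_gt0// mul1r.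
Qed.

Lemma scaled_leB p q k n :
  (p * 2 ^ k <= q * 2 ^ k + 2 ^ n)%N = (p%:R - 2 ^- k * 2 ^+ n <= q%:R :> R).
Proof.
rewrite -(ler_nat R) natrD !natrM !natrX -[RHS](ler_pM2r (exp2_gt0 R k)) mulrBl.
by rewrite [X in _ = (_ - X <= _)]mulrAC mulVf ?gt_eqF ?exp2_gt0// mul1r lerBlDr.
Qed.

Lemma name_geDP x y a b k : real_name x a -> real_name y b ->
  name_geD x y k <-> a + 2 ^- k <= b.
Proof.
move=> xa yb; rewrite -(real_name_le _ xa yb) /name_geD /approx.
by split=> H n; have := H n; rewrite scaled_leD !natrD; lra.
Qed.

Lemma name_geBP x y a b k : real_name x a -> real_name y b ->
  name_geB x y k <-> a - 2 ^- k <= b.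
Proof.
move=> xa yb; rewrite -(real_name_le _ xa yb) /name_geB /approx.
by split=> H n; have := H n; rewrite scaled_leB !natrD; lra.
Qed.

Lemma nearP x y a b m : 0 <= a -> 0 <= b -> real_name x a -> real_name y b ->
  near x y m <-> `|a - b| <= 2 ^- m.
Proof.
move=> a0 b0 /(real_name_npos a0) xa /(real_name_npos b0) yb.
have ab := real_name_le (- 2 ^- m) xa yb; have ba := real_name_le (- 2 ^- m) yb xa.
rewrite ler_norml; split=> [H|/andP[H1 H2] n].
  suff : a + - 2 ^- m <= b /\ b + - 2 ^- m <= a by lra.
  by split; [apply/ab | apply/ba] => n; have [] := H n;
    rewrite !scaled_leB !natrD /approx !npos_double !nneg_double; lra.
have /ab/(_ n) : a + - 2 ^- m <= b by lra.
have /ba/(_ n) : b + - 2 ^- m <= a by lra.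
by rewrite !scaled_leB !natrD /approx !npos_double !nneg_double; lra.
Qed.

Lemma name_unitP x a : real_name x a -> name_unit x <-> unitI R a.
Proof.
move=> /real_nameP xa; rewrite /unitI /= in_itv /=.
split=> [H|/andP[a0 a1] n].
  apply/andP; split; apply: (@le_exp2 _ _ _ 2) => n; have := xa n;
    have [] := H n; rewrite -!(ler_nat R) natrD natrX /approx mulrBl;
    have := ler0n R (npos (x n)); have := ler0n R (nneg (x n)); lra.
have := xa n; rewrite /approx -!(ler_nat R) natrD natrX.
have : 0 <= a * 2 ^+ n by rewrite mulr_ge0// ltW ?exp2_gt0.
have : a * 2 ^+ n <= 2 ^+ n by rewrite ler_piMl// ltW ?exp2_gt0.
by have := exp2_gt0 R n; case: (npos_nneg (x n)) => ->;
  have := ler0n R (npos (x n)); have := ler0n R (nneg (x n)); lra.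
Qed.

Lemma is_nameP x : is_name x <-> exists a, real_name x a.
Proof.
have E n m : (npos (x n) * 2 ^ m + nneg (x m) * 2 ^ n <=
    npos (x m) * 2 ^ n + nneg (x n) * 2 ^ m + 2 ^ n + 2 ^ m)%N =
    ((approx x n - 1) / 2 ^+ n <= (approx x m + 1) / 2 ^+ m).
  rewrite ler_pdivrMr ?exp2_gt0// mulrAC ler_pdivlMr ?exp2_gt0//.
  rewrite /approx; move: (npos (x n)) (npos (x m)) (nneg (x n)) (nneg (x m)).
  move=> p p' q q'; rewrite -(ler_nat R) !natrD !natrM !natrX.
  by rewrite !mulrDl !mulNr !mul1r; apply/idP/idP; lra.
split=> [H|[a /real_nameP xa] n m].
  have [n m|a Ha] := @nested _ (fun n => (approx x n - 1) / 2 ^+ n)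
    (fun n => (approx x n + 1) / 2 ^+ n); first by rewrite -E.
  exists a; apply/real_nameP => n; have := Ha n.
  by rewrite ler_pdivrMr ?ler_pdivlMr ?exp2_gt0//; lra.
rewrite E; apply: (@le_trans _ _ a).
  by rewrite ler_pdivrMr ?exp2_gt0//; have := xa n; lra.
by rewrite ler_pdivlMr ?exp2_gt0//; have := xa m; lra.
Qed.

Lemma to_name_id x a : real_name x a -> to_name x = x.
Proof.
move=> xa; apply/funext => n; rewrite /to_name /ite asboolT//.
by apply/is_nameP; exists a.
Qed.

Lemma to_name_real x : exists a, real_name (to_name x) a.
Proof.
have [/is_nameP[a xa]|nx] := pselect (is_name x).
  by exists a; rewrite (to_name_id xa).
exists 0; apply/real_nameP => n; rewrite /approx /to_name /ite asboolF//.
by rewrite -[0%N]/(2 * 0)%N npos_double nneg_double mul0r subrr subr0; lra.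
Qed.

Lemma name_exists a : exists x, real_name x a.
Proof.
pose code (m : int) := match m with Posz k => k.*2 | Negz k => k.*2.+1 end.
have codeK m : int_of_code (code m) = m.
  by case: m => k; rewrite /int_of_code /= odd_double //= ?doubleK// uphalf_double.
exists (fun n => code (Num.floor (a * 2 ^+ n))); apply/real_nameP => n.
rewrite /approx -int_of_codeE codeK.
by have := floor_itv (a * 2 ^+ n); rewrite intrD; lra.
Qed.

Lemma divn_approx p i : (p %/ 2 ^ i)%:R <= p%:R / 2 ^+ i :> R /\
  p%:R / 2 ^+ i < (p %/ 2 ^ i)%:R + 1 :> R.
Proof.
rewrite ler_pdivlMr ?ltr_pdivrMr ?exp2_gt0// natr1 -natrX -!natrM.
by rewrite ler_nat ltr_nat leq_divM ltn_ceil ?expn_gt0.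
Qed.

Lemma dyadic_nameP j i : real_name (dyadic_name j i) (j%:R / 2 ^+ i : R).
Proof.
apply/real_nameP => n; rewrite /approx npos_double nneg_double subr0.
have [] := divn_approx (j * 2 ^ n) i.
by rewrite natrM natrX mulrAC; lra.
Qed.

End names_of_reals.

(** * Cantor space inside the unit interval *)

Definition binary (z : nat -> nat) : Prop := forall i, (z i <= 1)%N.

Lemma odd_code m : odd m -> npos m = 0%N /\ (1 <= nneg m)%N.
Proof. by rewrite /npos /nneg => ->. Qed.

Lemma even_code m : ~~ odd m -> m = (2 * npos m)%N /\ nneg m = 0%N.
Proof.
rewrite /npos /nneg => /negbTE m0; rewrite m0 subn0 mul0n mul1n.
by split=> //; rewrite mul2n -[LHS]odd_double_half m0.
Qed.

Lemma cseq_binary w : binary (cseq w).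
Proof. by move=> i; rewrite /cseq; case: (w i). Qed.

Lemma binary_cseq z : binary z -> exists w, cseq w = z.
Proof.
move=> bz; exists (fun i => z i == 1%N); apply/funext => i.
by rewrite /cseq; have := bz i; case: (z i) => [|[|]].
Qed.

Lemma eq_expansion q d n z z' :
  agree n z z' -> expansion q d z n = expansion q d z' n.
Proof.
elim: n => //= n IH zz'; rewrite zz'// IH// => i /ltnW; exact: zz'.
Qed.

Section expansions.
Variable R : realType.
Implicit Types (a b c e : R) (x y z : nat -> nat).

Lemma norm_scaled a c e : 0 < e -> (`|a| <= c / e) = (- c <= a * e <= c).
Proof.
by move=> e0; rewrite ler_norml -mulNr ler_pdivrMr// ler_pdivlMr.
Qed.

(** The real with base-q digits z_i + d, characterised by the bounds on its partial expansions
    instead of as the sum of a series. *)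
Definition value q d z : R :=
  xget 0 [set a | forall n, (expansion q d z n)%:R <= a * q%:R ^+ n <=
                            (expansion q d z n)%:R + 1].

Section base.
Variables q d : nat.
Hypothesis dq : (d.+2 <= q)%N.

Let q2 : 2 <= q%:R :> R.
Proof. by rewrite (ler_nat R 2); apply: leq_trans dq. Qed.

Let qn_gt0 n : 0 < q%:R ^+ n :> R.
Proof. by rewrite exprn_gt0//; have := q2; lra. Qed.

(** The intervals [v n, v n + 1] / q^n are nested because both digits d and d + 1 are at most q -
    1. *)
Lemma value_bounds z : binary z -> forall n,
  (expansion q d z n)%:R <= value q d z * q%:R ^+ n <=
  (expansion q d z n)%:R + 1.
Proof.
move=> bz; pose v n : R := (expansion q d z n)%:R.
have vS n : q%:R * v n <= v n.+1 /\ v n.+1 + 1 <= q%:R * (v n + 1).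
  have := bz n; rewrite -(ler_nat R) => z1; have := ler0n R (z n).
  have := ler0n R d; move: dq; rewrite -(ler_nat R) -addn2 natrD => dqR.
  by rewrite /v /= !natrD natrM mulrDr mulr1; lra.
have lS n : v n / q%:R ^+ n <= v n.+1 / q%:R ^+ n.+1.
  rewrite ler_pdivrMr ?qn_gt0// mulrAC ler_pdivlMr ?qn_gt0// exprS mulrA.
  by rewrite ler_pM2r ?qn_gt0// mulrC; have [] := vS n.
have uS n : (v n.+1 + 1) / q%:R ^+ n.+1 <= (v n + 1) / q%:R ^+ n.
  rewrite ler_pdivrMr ?qn_gt0// mulrAC ler_pdivlMr ?qn_gt0// exprS mulrA.
  by rewrite ler_pM2r ?qn_gt0// [leRHS]mulrC; have [] := vS n.
have lu n : v n / q%:R ^+ n <= (v n + 1) / q%:R ^+ n.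
  by rewrite ler_pM2r ?invr_gt0 ?qn_gt0//; lra.
have lm : {homo (fun n => v n / q%:R ^+ n) : m n / (m <= n)%N >-> m <= n}.
  by apply: homo_leq => //; exact: le_trans.
have um : {homo (fun n => (v n + 1) / q%:R ^+ n) : m n / (m <= n)%N >-> n <= m}.
  by apply: homo_leq => //; move=> y x w xy yw; exact: le_trans yw xy.
have [n m|a Ha] := @nested _ (fun n => v n / q%:R ^+ n)
    (fun n => (v n + 1) / q%:R ^+ n).
  apply: le_trans (lm _ _ (leq_maxl n m)) _.
  exact: le_trans (lu _) (um _ _ (leq_maxr n m)).
apply: (@xgetPex _ _ [set a | forall n, (expansion q d z n)%:R <= a * q%:R ^+ n
  <= (expansion q d z n)%:R + 1]).
by exists a => n; have := Ha n; rewrite ler_pdivrMr ?ler_pdivlMr ?qn_gt0.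
Qed.

Lemma le_expn a b c : (forall n, (a - b) * q%:R ^+ n <= c) -> a <= b.
Proof.
move=> H; rewrite leNgt; apply/negP => ba.
suff : a <= b by rewrite leNgt ba.
apply: (@le_exp2 _ _ _ c) => n; apply: le_trans (H n).
by rewrite ler_pM2l ?subr_gt0// lerXn2r ?nnegrE//; have := q2; lra.
Qed.

Lemma value_unique z a c : binary z ->
  (forall n, - c <= a * q%:R ^+ n - (expansion q d z n)%:R <= c) ->
  a = value q d z.
Proof.
move=> bz H; have vz := value_bounds bz; apply/eqP; rewrite eq_le.
by apply/andP; split; apply: (@le_expn _ _ (c + 1)) => n; rewrite mulrBl;
  have := H n; have := vz n; lra.
Qed.

End base.

Lemma bin_nameP z : binary z -> real_name (bin_name z) (value 2 0 z).
Proof.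
move=> bz; apply/real_nameP => n.
rewrite /approx /bin_name npos_double nneg_double subr0.
by have := @value_bounds 2 0 isT _ bz n; lra.
Qed.

Lemma value2_agree n z z' : binary z -> binary z' -> agree n z z' ->
  `|value 2 0 z - value 2 0 z'| <= 2 ^- n.
Proof.
move=> bz bz' zz'; have := @value_bounds 2 0 isT _ bz n.
have := @value_bounds 2 0 isT _ bz' n; rewrite (eq_expansion _ _ zz') => H H'.
rewrite -[2 ^- n]mul1r norm_scaled ?exp2_gt0// mulrBl; lra.
Qed.

Lemma value2_unit z : binary z -> unitI R (value 2 0 z).
Proof.
move=> /(@value_bounds 2 0 isT)/(_ 0%N) /=; rewrite expr0 mulr1 /unitI /= in_itv /=.
by rewrite add0r.
Qed.

Lemma value2_surj a : unitI R a -> exists w, value 2 0 (cseq w) = a.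
Proof.
rewrite /unitI /= in_itv /= => a01.
(* Greedy expansion with remainder [t n]. The remainder may equal 1, so a = 1 gets the constant
   sequence 1. *)
pose t := fix t n : R := if n is n'.+1 then
  2 * t n' - (if 2^-1 <= t n' then 1 else 0) else a.
pose w : cantor_space := fun n => 2^-1 <= t n.
have t01 n : 0 <= t n <= 1.
  elim: n => //= n IH; case: ifPn => H; lra.
have E n : a * 2 ^+ n = (expansion 2 0 (cseq w) n)%:R + t n.
  elim: n => [|n IH] /=; first by rewrite expr0; lra.
  rewrite exprS mulrCA IH addn0 natrD natrM /cseq /w.
  by case: ifPn => _ /=; lra.
exists w; apply/esym/(@value_unique 2 0 isT _ _ 1); first exact: cseq_binary.
by move=> n; rewrite E; have := t01 n; lra.
Qed.

(** Two further digits, each 1 or 2, bound the tail by (4 + 1) / 16 and (8 + 2 + 1) / 16. The margin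
    5/16 exceeds the reading error 1/4. *)
Lemma value4_bounds z n : binary z ->
  (expansion 4 1 z n)%:R + 5 / 16 <= value 4 1 z * 4 ^+ n <=
  (expansion 4 1 z n)%:R + 11 / 16.
Proof.
move=> bz; have := @value_bounds 4 1 isT _ bz n.+2.
rewrite /= !exprS !(natrD, natrM).
have := bz n; have := bz n.+1; rewrite -!(ler_nat R).
have := ler0n R (z n); have := ler0n R (z n.+1).
by move: (4 ^+ n) (expansion 4 1 z n) => P v; lra.
Qed.

Lemma quat_nameP z : binary z -> real_name (quat_name z) (value 4 1 z).
Proof.
move=> bz; apply/real_nameP => n.
rewrite /approx /quat_name npos_double nneg_double subr0.
have := @value_bounds 4 1 isT _ bz n.
have [] := divn_approx R (expansion 4 1 z n) n.
set v := expansion _ _ _ _; rewrite ltr_pdivrMr ?ler_pdivlMr ?exp2_gt0// => l u.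
have -> : (4 : R) ^+ n = 2 ^+ n * 2 ^+ n by rewrite -exprMn; congr (_ ^+ n); lra.
rewrite mulrA => H; set A := value 4 1 z * 2 ^+ n in H *.
(* Integrality improves the strict bound by one, which absorbs the 1 in the upper bound for the
   value. *)
have {}u : v%:R + 1 <= ((v %/ 2 ^ n)%:R + 1) * 2 ^+ n :> R.
  move: u; rewrite natr1 -natrX -natrM ltr_nat => u.
  by rewrite natr1 ler_nat.
have l' : (v %/ 2 ^ n)%:R <= A.
  rewrite -(ler_pM2r (exp2_gt0 R n)); lra.
have u' : A <= (v %/ 2 ^ n)%:R + 1.
  rewrite -(ler_pM2r (exp2_gt0 R n)); lra.
lra.
Qed.

Lemma in_range_digits x z : binary z -> real_name x (value 4 1 z) ->
  in_range x /\ digits x = z.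
Proof.
move=> bz /real_nameP xa; pose v := expansion 4 1 z.
have E n : x (2 * n + 2)%N = (2 * npos (x (2 * n + 2)%N))%N /\
    prefix x n = v n.
  have := value4_bounds n bz; have := xa (2 * n + 2)%N; rewrite exprD exprM.
  have -> : (2 : R) ^+ 2 = 4 by rewrite expr2; lra.
  rewrite mulrA /approx /prefix -/(v n); move: (x _) => c.
  move: (value _ _ _ * _) => A; have v0 := ler0n R (v n).
  (* An odd code is an entry of at most -1, impossible for a scaled value of at least 5/4. *)
  have [/odd_code[-> c1]|/even_code[cE ->]] := boolP (odd c).
    rewrite mulr0n sub0r opprK.
    move=> H1 H2; have c1R : 1 <= (nneg c)%:R :> R by rewrite (ler_nat R 1).
    exfalso; lra.
  rewrite subr0 [X in (X %/ _)%N]cE => H1 H2; split=> //; set p := npos c in H1 H2 *.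
  (* The scaled value lies in [4 v + 5/4, 4 v + 11/4]; an error of one unit keeps p in [4 v, 4 v +
     4[. *)
  have : (4 * v n < p.+1 /\ p < 4 * v n + 4)%N.
    by rewrite -!(ltr_nat R) natrD natrM -natr1; lra.
  by rewrite -[(2 ^ 3)%N]/(2 * 4)%N divnMl//; lia.
have dz : digits x = z.
  apply/funext => i; rewrite /digits.
  have -> : (2 * i + 4 = 2 * i.+1 + 2)%N by lia.
  rewrite -/(prefix x i.+1); have [_ ->] := E i.+1; rewrite /v /=.
  by have := bz i; lia.
split=> //; split; first by have [_ ->] := E 0%N.
move=> n; have [En ->] := E n; have [_ ->] := E n.+1; split.
  by rewrite En oddM.
by rewrite /v /=; have := bz n; case: (z n) => [|[|//]] _; [left | right]; lia.
Qed.

Lemma in_range_value x a : real_name x a -> in_range x ->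
  a = value 4 1 (digits x).
Proof.
move=> /real_nameP xa [x0 H].
have E n : prefix x n = expansion 4 1 (digits x) n.
  elim: n => [|n IH] //=; rewrite -IH.
  have -> : digits x n = (1 - odd (prefix x n.+1))%N.
    by rewrite /digits /prefix; congr (1 - odd (x _ %/ _))%N; lia.
  by have [_ [->|->]] := H n; rewrite oddD oddM /=; lia.
apply: (@value_unique 4 1 isT _ _ 2) => [i|n]; first by rewrite /digits; lia.
rewrite -E; have := xa (2 * n + 2)%N; rewrite exprD exprM.
have -> : (2 : R) ^+ 2 = 4 by rewrite expr2; lra.
rewrite mulrA /approx /prefix; have [+ _] := H n; move: (x _) => c.
move: (a * _) => A /negP /even_code[cE ->]; rewrite subr0 [X in (X %/ _)%N]cE.
rewrite -[(2 ^ 3)%N]/(2 * 4)%N divnMl//; set p := npos c.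
have : (4 * (p %/ 4) <= p /\ p <= 4 * (p %/ 4) + 3)%N by lia.
by rewrite -!(ler_nat R) natrD natrM; lra.
Qed.

End expansions.

(** * The image of a closed set and its complement *)

Section image.
Variable R : realType.
Implicit Types (a b c e : R) (x z : nat -> nat) (X : tot ty2).

Definition embed (w : cantor_space) : R := value R 4 1 (cseq w).

Lemma embed_inj w w' : embed w = embed w' -> cseq w = cseq w'.
Proof.
move=> E; have [x xa] := name_exists (embed w).
have [_ <-] := in_range_digits (cseq_binary w) xa.
by rewrite E in xa; have [_ <-] := in_range_digits (cseq_binary w') xa.
Qed.

(** Both tails lie in [5/16, 11/16], an interval of length 6/16. *)
Lemma embed_agree n w w' : agree n (cseq w) (cseq w') ->
  `|embed w - embed w'| <= 6 / 16 / 4 ^+ n.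
Proof.
move=> ww'; rewrite norm_scaled ?exprn_gt0 ?ltr0n// mulrBl.
have := value4_bounds R n (cseq_binary w).
have := value4_bounds R n (cseq_binary w').
by rewrite (eq_expansion _ _ ww') /embed; lra.
Qed.

Lemma embed_bounds w : 5 / 16 <= embed w <= 11 / 16.
Proof.
by have := value4_bounds R 0 (cseq_binary w); rewrite expr0 mulr1 /= !add0r.
Qed.

Lemma le_exp4 n : 4 ^- n <= 2 ^- n :> R.
Proof.
rewrite lef_pV2 ?posrE ?exprn_gt0 ?ltr0n//.
by apply: lerXn2r; rewrite ?nnegrE ?ler_nat.
Qed.

Lemma embed_continuous : continuous embed.
Proof.
move=> w U /nbhs_ballP[e /= e0 eU]; have [n ne] := exp2N_lt e0.
apply: filterS (cylinder_nbhs w n) => w' /= /embed_agree ww'.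
apply: eU; rewrite /ball/=; have := le_exp4 n.
have : 0 < 4 ^- n :> R by rewrite invr_gt0 exprn_gt0 ?ltr0n.
by move: ww'; lra.
Qed.

Definition image X : set R := embed @` cset X.

Lemma in_imageP X x a : real_name x a -> in_image X x <-> image X a.
Proof.
move=> xa; split=> [[xr Xx]|[w Xw wa]].
  rewrite (in_range_value xa xr).
  have [|w wE] := @binary_cseq (digits x); first by move=> i; rewrite /digits; lia.
  by exists w; rewrite /embed/cset/= wE.
rewrite -wa in xa; have [xr dx] := in_range_digits (cseq_binary w) xa.
by split=> //; rewrite dx.
Qed.

Lemma image_embed X w : image X (embed w) -> X (cseq w) = 1%N.
Proof. by move=> [w' Xw' /embed_inj <-]. Qed.

Lemma image_compl_ball X a : closed (cset X) -> ~ image X a ->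
  exists2 d, 0 < d & forall y, `|y - a| < d -> ~ image X y.
Proof.
move=> cX Xa.
have : compact (cset X) by exact: subclosed_compact cX cantor_space_compact _.
move=> /(continuous_compact (continuous_subspaceT embed_continuous)).
move=> /(compact_closed (@Rhausdorff R))/closed_openC oX.
have /nbhs_ballP[d /= d0 dX] : nbhs a (~` image X) by apply: open_nbhs_nbhs.
by exists d => // y ya; apply: dX; rewrite /ball/= distrC.
Qed.

Lemma image_bounds X a : image X a -> 5 / 16 <= a <= 11 / 16.
Proof. by move=> [w _ <-]; exact: embed_bounds. Qed.

Definition indic X a : R := if `[< image X a >] then 1 else 0.

Lemma indic_name X x a : real_name x a -> real_name (ind_name X x) (indic X a).
Proof.
move=> xa; apply/real_nameP => n.
rewrite /approx /ind_name /ite (asbool_equiv_eq (in_imageP X xa)) /indic.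
case: asboolP => _; last first.
  by rewrite -[0%N]/(2 * 0)%N npos_double nneg_double mul0r subrr subr0; lra.
by rewrite expnS npos_double nneg_double natrX subr0 mul1r subrr; lra.
Qed.

Lemma indic_near X a : closed (cset X) -> ~ image X a ->
  exists2 d, 0 < d & forall y, `|y - a| < d -> indic X y = 0.
Proof.
move=> cX /(image_compl_ball cX)[d d0 H].
by exists d => // y /H Xy; rewrite /indic asboolF.
Qed.

Lemma indic_usco X : closed (cset X) -> usco (indic X).
Proof.
move=> cX; apply/uscoP => a _ c; have [Xa|Xa] := pselect (image X a).
  rewrite /indic asboolT// => c1; exists 1 => // y _ _.
  by apply: le_lt_trans c1; case: ifP.
have [d d0 H] := indic_near cX Xa; rewrite /indic asboolF// => c0.
by exists d => // y _ /H; rewrite /indic => ->.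
Qed.

Lemma indic_modulus X F a : closed (cset X) -> is_modulus (indic X) F ->
  unitI R a -> ~ image X a -> forall y, `|y - a| < 2 ^- F a 0%N -> ~ image X y.
Proof.
move=> cX HF Ia Xa y ya Xy.
have ca : cont_points (indic X) a.
  apply/cont_pointP; split=> // e e0; have [d d0 H] := indic_near cX Xa.
  exists d => // z _ /H ->; rewrite (H a) ?subrr ?normr0//.
have Iy : unitI R y.
  by have := image_bounds Xy; rewrite /unitI/= in_itv/=; lra.
have := HF 0%N a y ca Iy; rewrite distrC => /(_ ya).
by rewrite /indic asboolF// asboolT// sub0r normrN normr1 expr0 invr1 ltxx.
Qed.

(** The balls of [R2_open] are balls of the whole line, so 0 and 1 must be left out; the image stays
    away from both. *)
Definition compl X : set R := [set a | 0 < a < 1 /\ ~ image X a].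

Lemma gap_minn x n : gap x n = minn (npos (x n)) (2 ^ n - npos (x n)).
Proof. by rewrite /gap; lia. Qed.

Lemma npos_approx x a n : 0 <= a -> real_name x a ->
  -1 <= a * 2 ^+ n - (npos (x n))%:R <= 1.
Proof.
move=> a0 /(real_name_npos a0) /real_nameP/(_ n).
by rewrite /approx npos_double nneg_double subr0.
Qed.

Lemma gapP x a : real_name x a -> (exists n, 2 <= gap x n)%N <-> 0 < a < 1.
Proof.
move=> xa; split=> [[n]|/andP[a0 a1]].
  rewrite gap_minn leq_min => /andP[p2 p2'].
  have n0 : nneg (x n) = 0%N by have [E|] := npos_nneg (x n); move: p2; rewrite ?E.
  have := (real_nameP _ _).1 xa n; rewrite /approx n0 subr0 => H.
  have : (2 + npos (x n) <= 2 ^ n)%N by lia.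
  move: p2; rewrite -!(ler_nat R) natrD natrX => p2 p3.
  apply/andP; split; rewrite -(ltr_pM2r (exp2_gt0 R n)); lra.
(* Three units of distance to 0 and to 1 leave two after rounding. *)
have [n Hn] := exp2_gt (3 / a + 3 / (1 - a)); exists n.
have a3 : 3 < a * 2 ^+ n.
  rewrite mulrC -ltr_pdivrMr//; apply: le_lt_trans Hn.
  by rewrite lerDl divr_ge0//; lra.
have b3 : 3 < (1 - a) * 2 ^+ n.
  rewrite mulrC -ltr_pdivrMr ?subr_gt0//; apply: le_lt_trans Hn.
  by rewrite lerDr divr_ge0//; lra.
have p0 := npos_approx n (ltW a0) xa.
have p1 : (2 <= npos (x n))%N by rewrite -(ler_nat R); lra.
have : (npos (x n) + 2 <= 2 ^ n)%N.
  by rewrite -(ler_nat R) natrD natrX; move: b3; rewrite mulrBl; lra.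
by rewrite gap_minn leq_min p1 /=; lia.
Qed.

Lemma in_complP X x a : real_name x a -> in_compl X x <-> compl X a.
Proof.
by move=> xa; rewrite /in_compl /compl /= (gapP xa) (in_imageP X xa).
Qed.

Lemma compl_char_name X : set_name (compl_char X) (compl X).
Proof.
by move=> x a /(in_complP X) xa; rewrite /compl_char /ite (asbool_equiv_eq xa).
Qed.

Definition radius X (N : R -> nat) a : R :=
  if `[< compl X a >] then Num.min (2 ^- N a) (Num.min a (1 - a)) else 0.

(** The minimum is 1-Lipschitz, so approximations of its three terms within one unit suffice. The
    case p > T is separate, because T - p is then truncated to 0. *)
Lemma radius_nameP X N r x a : real_name x a -> r x = N a ->
  real_name (radius_name X r x) (radius X N a).
Proof.
move=> xa rN; apply/real_nameP => n; rewrite /approx /radius_name /radius /ite.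
rewrite (asbool_equiv_eq (in_complP X xa)); case: asboolP => [[a01 _]|_];
  last first.
  by rewrite -[0%N]/(2 * 0)%N npos_double nneg_double mul0r subrr subr0; lra.
rewrite npos_double nneg_double subr0 rN gap_minn.
have [] := divn_approx R (2 ^ n) (N a).
rewrite natrX !minr_pMl ?(ltW (exp2_gt0 R n))// [_^-1 * _]mulrC.
have := npos_approx n (ltW (proj1 (andP a01))) xa.
have al : 0 < (1 - a) * 2 ^+ n by rewrite mulr_gt0 ?exp2_gt0 ?subr_gt0//; lra.
move: al; rewrite mulrBl mul1r; have := natrX R 2 n.
move: (npos _) (2 ^ n)%N (2 ^ n %/ _)%N (2 ^+ n) (_ / _) (a * _).
move=> p T u P A B <- B1 pB uA uA'.
have E : (minn p (T - p) - (minn p (T - p) - u))%N = minn u (minn p (T - p)).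
  by lia.
rewrite E; case: (leqP p T) => pT; last first.
  have -> : minn u (minn p (T - p)) = 0%N by lia.
  move: pT; rewrite -(ler_nat R) -natr1 => pT.
  rewrite mulr0n subr0.
  by case: (leP B (T%:R - B)) => ?; case: (leP A _) => ?; lra.
have := natrB R pT; move: (T - p)%N => t tE; move: pT; rewrite -(ler_nat R) => pT.
case: (leqP p t); rewrite -?(ltr_nat R) -?(ler_nat R) => ?;
  [case: (leqP u p) | case: (leqP u t)];
  rewrite -?(ltr_nat R) -?(ler_nat R) => ?;
  case: (leP B (T%:R - B)) => ?; case: (leP A _) => ?; lra.
Qed.

Lemma compl_R2_open X N :
  (forall a, compl X a -> forall y, `|y - a| < 2 ^- N a -> ~ image X y) ->
  R2_open (compl X) (radius X N).
Proof.
move=> HN; split=> [a [/andP[a0 a1] _]|a].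
  by rewrite /unitI /= in_itv /= !ltW.
rewrite /radius; split=> [Oa|].
  rewrite asboolT//; have [/andP[a0 a1] _] := Oa; split.
    by rewrite !lt_min a0 subr_gt0 a1 invr_gt0 exp2_gt0.
  move=> y; rewrite /ball /= !lt_min => /and3P[yN ya ya1]; split.
    by move: ya ya1; rewrite !ltr_norml; lra.
  by apply: (HN a Oa); rewrite distrC.
case: asboolP => // -[/andP[a0 a1] _].
by move=> /eqP; rewrite gt_eqF// !lt_min a0 subr_gt0 a1 invr_gt0 exp2_gt0.
Qed.

End image.

(** * Computing Omega_C *)

(* The first argument of M quantifies over Baire space: S8 requires the
   functional computed there to be total, so the call diverges as soon as F
   is undefined somewhere. *)
Lemma kleene_guard W (Γ : ctx W) (M : part ty_Musco) F :
  has Γ (fun=> @parg ty_Musco M) -> pcomp (push ty1 (push tyN Γ)) F ->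
  exists e, forall w,
    (forall n, kleene e (vals Γ w) n ->
       forall u k, exists b, F (u, (k, w)) = Some b) /\
    ((forall u k, F (u, (k, w)) = Some 0%N) -> forall n,
       M (fun _ _ => 0%N) (fun=> 0%N) 0%N = Some n -> kleene e (vals Γ w) n).
Proof.
move=> [i iN Gi] [e1 H1]; pose z := idx [:: 2; 0]%N.
have [e He] := @kleene_app [:: ty11; ty1; tyN] _ _ [:: e1; z; z] iN.
have {}He w n := He (vals Γ w) M n (size_vals Γ w).
exists e => w; have {}He := He w _ _; rewrite nth_vals// Gi in He.
have argE u k : args_of (l := [:: ty1; tyN]) (u, (k, tt)) ++ vals Γ w =
  vals (push ty1 (push tyN Γ)) (u, (k, w)) by rewrite !vals_push.
split=> [n /He[//|[g gs] /kleene_args_inv/= [_ [_ [[<- _] Hg _]]] _] u k|H n Mn].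
  by exists (g u k); apply/H1; rewrite -argE; exact: Hg.
apply/He => //; exists (fun _ _ => 0%N, (fun=> 0%N, (0%N, tt))) => //.
constructor=> [[u [k []]]|]; first by rewrite argE; apply/H1; rewrite H.
by do 2!(constructor=> [xi|]; first exact: S2); constructor.
Qed.

(** * Coverings of [1/4, 3/4] by a code *)

Section covering.
Variable R : realType.
Implicit Types (a b c e : R).

Lemma nat_floor a : 0 <= a -> exists k : nat, k%:R <= a < k%:R + 1.
Proof.
move=> a0; exists (Num.truncn a).
by have := truncn_itv a0; rewrite natr1.
Qed.

Lemma exp2_gt_mul c e : 0 < e ->
  exists m, forall n, (m <= n)%N -> c < e * 2 ^+ n.
Proof.
move=> e0; have [m Hm] := exp2_gt (c / e); exists m => n mn.
rewrite mulrC -ltr_pdivrMr//; apply: lt_le_trans Hm _.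
by rewrite ler_weXn2l// (ler_nat R 1).
Qed.

Section code.
Variables (d : nat -> nat -> nat -> nat) (a b : nat -> R).
Hypothesis da : forall n, real_name (d 0 n) (a n).
Hypothesis db : forall n, real_name (d 1 n) (b n).

(** The cell of c is found by a floor; c < 3/4 keeps it among the 2^(L+1) cells listed, and the
    image stays below 11/16. *)
Lemma covers_sub : covers d -> forall c, 4^-1 <= c < 3 / 4 ->
  exists n, a n < c < b n.
Proof.
move=> [L H] c /andP[c1 c2].
have Q0 := exp2_gt0 R L.
have [|k /andP[k1 k2]] := @nat_floor (c * (4 * 2 ^+ L)).
  by rewrite mulr_ge0//; lra.
have kL : (2 ^ L <= k)%N.
  rewrite -ltnS -(ltr_nat R) natrX -[k.+1%:R]natr1.
  by apply: le_lt_trans k2; nra.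
have [j kE] : exists j, k = (2 ^ L + j)%N by exists (k - 2 ^ L)%N; rewrite subnKC.
have jL : (j.+1 <= 2 * 2 ^ L)%N.
  rewrite -(ltn_add2l (2 ^ L)) -kE -(ltr_nat R); apply: le_lt_trans k1 _.
  by rewrite natrD natrM natrX; nra.
have [n [m]] := H j jL; rewrite -kE.
move: (da n) (db n) => /real_nameP/(_ m) + /real_nameP/(_ m).
have B0 : (0 < npos (d 1 n m))%N -> nneg (d 1 n m) = 0%N.
  by case: (npos_nneg (d 1 n m)) => ->.
rewrite /approx; move: (npos (d 0 n m)) (nneg (d 0 n m)) (nneg (d 1 n m)) B0.
move: (npos (d 1 n m)) => B A A' B' B0.
have M0 := exp2_gt0 R m; have := ler0n R A'; have := ler0n R k.
rewrite -!(ler_nat R) !(natrD, natrM, natrX).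
have [B00|/B0 ->] := posnP B.
  by rewrite B00 mulr0n mul0r => k0 _ _ _ [_ bad]; exfalso; nra.
rewrite mulr0n subr0 => k0 A'0 H1 H2 [H3 H4]; exists n.
apply/andP; split.
  rewrite -(ltr_pM2r M0) -(ltr_pM2r (mulr_gt0 (ltr0n R 4) Q0)).
  apply: le_lt_trans (_ : (A%:R + 1) * (4 * 2 ^+ L) < _).
    by rewrite ler_pM2r ?mulr_gt0 ?ltr0n//; lra.
  apply: lt_le_trans (_ : k%:R * 2 ^+ m <= _); first lra.
  by rewrite mulrAC ler_pM2r.
rewrite -(ltr_pM2r M0) -(ltr_pM2r (mulr_gt0 (ltr0n R 4) Q0)).
apply: lt_le_trans (_ : (B%:R - 1) * (4 * 2 ^+ L) <= _); last first.
  by rewrite ler_pM2r ?mulr_gt0 ?ltr0n//; lra.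
apply: lt_trans (_ : (k%:R + 1) * 2 ^+ m < _); last lra.
by rewrite mulrAC ltr_pM2r.
Qed.

(** A Lebesgue number argument: compactness gives one L such that every point has margin 2^-L inside
    some interval, and a cell is four times shorter than that margin. *)
Lemma sub_covers : (forall c, 4^-1 <= c <= 3 / 4 -> exists n, a n < c < b n) ->
  covers d.
Proof.
move=> H.
have := @segment_compact R 4^-1 (3 / 4).
move=> /compact_near_coveringP/(_ nat \oo
  (fun L c => exists n, a n + 2 ^- L < c < b n - 2 ^- L) _).
case=> [c|L _ HL].
  rewrite /= in_itv/= => /H[n /andP[ac cb]].
  have [L HL] := @exp2N_lt R (Num.min (c - a n) (b n - c) / 2) ltac:(
    by rewrite divr_gt0// lt_min !subr_gt0 ac cb).
  have [H1 H2] : 2 * 2 ^- L < c - a n /\ 2 * 2 ^- L < b n - c.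
    by apply/andP; rewrite -lt_min mulrC -ltr_pdivlMr.
  exists (ball c (2 ^- L), [set L' | (L <= L')%N]).
    split; last by exists L.
    by apply/nbhs_ballP; exists (2 ^- L) => //=; rewrite invr_gt0 exp2_gt0.
  move=> [c' L'] /= []; rewrite /ball/= ltr_norml => cc' LL'; exists n.
  have : 2 ^- L' <= 2 ^- L :> R.
    by rewrite lef_pV2 ?posrE ?exp2_gt0// ler_weXn2l// (ler_nat R 1).
  lra.
exists L => j jL; have Q0 := exp2_gt0 R L.
have [|n /andP[an bn]] := HL L (leqnn L) ((2 ^ L + j)%N%:R / (4 * 2 ^+ L)).
  rewrite /= in_itv/= ler_pdivlMr ?ler_pdivrMr ?mulr_gt0 ?ltr0n//.
  move: jL; rewrite -(ltr_nat R) natrD natrM natrX; have := ler0n R j; nra.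
pose k := (2 ^ L + j)%N; rewrite -/k in an bn *; pose Q : R := 4 * 2 ^+ L.
have Qp : 0 < Q by rewrite mulr_gt0.
rewrite -/Q in an bn.
have k0 : 0 < k%:R :> R by rewrite ltr0n /k addn_gt0 expn_gt0.
have QL : Q * 2 ^- L = 4 by rewrite /Q -mulrA mulfV ?mulr1// gt_eqF.
have e1 : 0 < k%:R - Q * a n.
  have L0 : 0 < 2 ^- L :> R by rewrite invr_gt0.
  have : a n < k%:R / Q by lra.
  by rewrite ltr_pdivlMr//; lra.
have e2 : 0 < Q * b n - (k%:R + 1).
  move: bn; rewrite ltrBrDr -(ltr_pM2r Qp) mulrDl divfK ?gt_eqF//.
  by rewrite [2 ^- L * Q]mulrC QL; lra.
(* The name's rounding error and the unit required by [covers] cost Q each, and strictness costs 1.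
   [m0] serves the case where the entry for a n is negative and read as 0. *)
have [m0 Hm0] := exp2_gt_mul (2 * Q + 1) k0.
have [m1 Hm1] := exp2_gt_mul (2 * Q + 1) e1.
have [m2 Hm2] := exp2_gt_mul (2 * Q + 1) e2.
pose m := maxn m0 (maxn m1 m2).
have {}Hm0 := Hm0 m (leq_maxl _ _).
have {}Hm1 : 2 * Q + 1 < (k%:R - Q * a n) * 2 ^+ m.
  by apply: Hm1; rewrite /m !leq_max leqnn !orbT.
have {}Hm2 : 2 * Q + 1 < (Q * b n - (k%:R + 1)) * 2 ^+ m.
  by apply: Hm2; rewrite /m !leq_max leqnn !orbT.
have QE : 4 * 2 ^+ L = Q by [].
exists n, m; rewrite -/k; clearbody k m Q.
move: (da n) (db n) => /real_nameP/(_ m) + /real_nameP/(_ m).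
rewrite /approx; have := npos_nneg (d 0 n m).
move: (npos (d 0 n m)) (nneg (d 0 n m)) (nneg (d 1 n m)) => A A' B'.
move: (npos (d 1 n m)) => B AA'; have := ler0n R B'.
rewrite -!(ler_nat R) !(natrD, natrM, natrX) QE.
move: Hm1 Hm2; rewrite !mulrBl => Hm1 Hm2 B0 A1 B1; split.
  case: AA' A1 => -> A1; first by rewrite mulr0n; lra.
  have : A%:R * Q <= (a n * 2 ^+ m + 1) * Q.
    by rewrite ler_pM2r//; move: A1; rewrite mulr0n; lra.
  lra.
have : (b n * 2 ^+ m - 1) * Q <= B%:R * Q by rewrite ler_pM2r//; lra.
lra.
Qed.

End code.
End covering.

(** * The validity check and the decision of emptiness *)

Definition merge (z z' : nat -> nat) (i : nat) : nat :=
  if odd i then z' (i./2)%N else z (i./2)%N.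

Lemma evens_merge z z' : binary z -> evens (merge z z') = z.
Proof.
move=> bz; apply/funext => i; rewrite /evens /merge mul2n odd_double doubleK.
by have := bz i; case: (z i) => [|[|]].
Qed.

Lemma odds_merge z z' : binary z' -> odds (merge z z') = z'.
Proof.
move=> bz; apply/funext => i; rewrite /odds /merge mul2n addn1 /= odd_double /=.
by rewrite uphalf_double; have := bz i; case: (z' i) => [|[|]].
Qed.

Lemma evens_binary u : binary (evens u).
Proof. by move=> i; rewrite /evens; case: odd. Qed.

Lemma odds_binary u : binary (odds u).
Proof. by move=> i; rewrite /odds; case: odd. Qed.

Section omega_from_musco.
Variables (R : realType) (M : part ty_Musco) (Delta : part ty_Delta).
Hypotheses (HM : is_Musco R M) (HD : is_Delta R Delta).

Definition valid (X : tot ty2) : Prop := is_char X /\ closed (cset X).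

Definition check (X : tot ty2) (u : nat -> nat) : option nat :=
  obind (fun N => if `[< check_prop X N u >] then Some 0%N else None)
    (M (ind_name X) (quat_name (evens u)) 0%N).

(** X is arbitrary, so [ind_name X] may name no usco function and the answer N of M may be
    meaningless. Yet N depends only on z, not on z', so the cylinder of length N about z outside X
    avoids X. *)
Lemma check_valid X : (forall u, exists b, check X u = Some b) -> valid X.
Proof.
move=> H.
have {}H z z' : binary z -> binary z' -> exists2 N,
    M (ind_name X) (quat_name z) 0%N = Some N & (X z <= 1)%N /\
    (X z = 0%N -> agree N z z' -> X z' = 0%N).
  move=> bz bz'; have [b] := H (merge z z'); rewrite /check evens_merge//.
  case: (M _ _ _) => [N|//] /=; case: asboolP => // -[+ +] _.
  by rewrite evens_merge// odds_merge//; exists N.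
split=> [z|]; first by have [N _ []] := H _ _ (cseq_binary z) (cseq_binary z).
apply/closed_cylinderP => z; rewrite /cset /= => Xz.
have bz := cseq_binary z.
have [N MN [Xz1 _]] := H _ _ bz bz.
have Xz0 : X (cseq z) = 0%N by case: (X _) Xz Xz1 => [|[|]].
exists N => z' zz'; have [N' + [_ /(_ Xz0)]] := H _ _ bz (cseq_binary z').
by rewrite MN => -[<-] /(_ zz') ->.
Qed.

Lemma musco_indic X : closed (cset X) -> exists N : R -> nat,
  (forall x a, real_name x a -> M (ind_name X) x 0%N = Some (N a)) /\
  (forall a, unitI R a -> ~ image X a -> forall y, `|y - a| < 2 ^- N a ->
     ~ image X y).
Proof.
move=> cX; have [F HF] := HM; have [mF FM] := HF _ (indic_usco (R := R) cX).
exists (fun a => F (indic X) a 0%N); split=> [x a|a Ia Xa y].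
  by apply: FM => y b _; exact: indic_name.
exact: indic_modulus cX mF Ia Xa y.
Qed.

(** Sequences agreeing on N digits have images closer than 2^-N, within the radius that the modulus
    guarantees to avoid the image. *)
Lemma valid_check X : valid X -> forall u, check X u = Some 0%N.
Proof.
move=> [char_X cX] u; have [N [MN HN]] := musco_indic cX.
have be := evens_binary u; have bo := odds_binary u.
have [w wE] := binary_cseq be; have [w' w'E] := binary_cseq bo.
rewrite /check (MN _ _ (quat_nameP R be)) /= asboolT//.
rewrite /check_prop -wE -w'E; split=> // Xw ww'.
have := char_X w'; case E: (X (cseq w')) => [|[|]]// _.
have ew := embed_bounds R w.
have Iw : unitI R (embed R w) by rewrite /unitI /= in_itv /=; lra.
case: (HN _ Iw _ (embed R w')); last by exists w'.
  by move/image_embed; rewrite Xw.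
rewrite -/(embed R w) in ww'; set n := N _ in ww' *.
rewrite distrC; apply: le_lt_trans (embed_agree R ww') _.
have := le_exp4 R n; have : 0 < 4 ^- n :> R by rewrite invr_gt0 exprn_gt0.
lra.
Qed.

(** When all checks succeed, the functional handed to M by the guard is constantly 0, a name of the
    zero function, so the call converges. *)
Lemma musco_zero : exists n, M (fun _ _ => 0%N) (fun=> 0%N) 0%N = Some n.
Proof.
have [F HF] := HM; have [|_ H] := HF (fun=> 0).
  by apply/uscoP => a _ c c0; exists 1.
have z : real_name (fun=> 0%N) (0 : R).
  apply/real_nameP => n; rewrite -[0%N]/(2 * 0)%N /approx npos_double nneg_double.
  by rewrite mul0r subrr subr0; lra.
by exists (F (fun=> 0) 0 0%N); apply: H.
Qed.

Lemma omega_from_musco : @computable_in (Ty [:: ty2]) Omega_C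
  [:: @parg ty_Musco M; @parg ty_Delta Delta; @targ ty2 E2].
Proof.
pose Γ : ctx (tot ty2) := [:: @targ ty2; fun=> @parg ty_Musco M;
  fun=> @parg ty_Delta Delta; fun=> @targ ty2 E2].
have [eg Hg] : exists e, forall X,
    (forall n, kleene e (vals Γ X) n ->
       forall u (k : nat), exists b, check X u = Some b) /\
    ((forall u (k : nat), check X u = Some 0%N) -> forall n,
       M (fun _ _ => 0%N) (fun=> 0%N) 0%N = Some n -> kleene e (vals Γ X) n).
  apply: (@kleene_guard _ Γ M (fun p => check p.2.2 p.1)); first solve_has.
  apply: (@pcomp_let _ (push ty1 (push tyN Γ))
    (fun p => M (ind_name p.2.2) (quat_name (evens p.1)) 0%N)
    (fun q => if `[< check_prop q.2.2.2 q.1 q.2.1 >] then Some 0%N else None)).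
    apply: (@pcomp_ind_Musco _ _ (fun p => p.2.2) M
      (fun p => quat_name (evens p.1))); try solve_has.
    apply: (@comp1_quat_name _ _ (fun p => evens p.1)).
    by rewrite /comp1 /evens; comp_tac.
  apply: (@pcomp_assert _ _ (fun q => check_prop q.2.2.2 q.1 q.2.1)).
  by apply: (@compP_check _ _ (fun q => q.2.2.2) (fun q => q.2.1)); try solve_has;
    [apply: comp1_var; solve_has | comp_tac].
(* The decision program is verified on valid X only. For these the defaults in [r], and in [d] for s
   <= 1, are never reached. *)
pose V := {X : tot ty2 | valid X}.
pose ΓV : ctx V := [:: fun X => @targ ty2 (sval X); fun=> @parg ty_Musco M;
  fun=> @parg ty_Delta Delta; fun=> @targ ty2 E2].
pose r (X : V) x := odflt 0%N (M (ind_name (sval X)) (to_name x) 0%N).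
pose d (X : V) s n m := odflt 0%N
  (Delta (compl_char (sval X)) (radius_name (sval X) (r X)) E2 s n m).
have Mr X x : M (ind_name (sval X)) (to_name x) 0%N = Some (r X x).
  have [N [MN _]] := musco_indic (svalP X).2.
  have [a xa] := to_name_real R x.
  by rewrite /r (MN _ _ xa).
have [ad [bd Hd]] := HD.
have dP (X : V) : exists U a b, [/\ U = @compl R (sval X), RM_code U a b,
    forall n, computes_name (Delta (compl_char (sval X))
      (radius_name (sval X) (r X)) E2 0%N n) (a n) &
    forall n, computes_name (Delta (compl_char (sval X))
      (radius_name (sval X) (r X)) E2 1%N n) (b n)].
  have [N [MN HN]] := musco_indic (svalP X).2.
  have [|cO HO] := Hd (@compl R (sval X)) (radius (sval X) N).
    apply: compl_R2_open => a [/andP[a0 a1] Xa]; apply: HN Xa.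
    by rewrite /unitI /= in_itv /= !ltW.
  exists (compl (sval X)); eexists; eexists; split=> //; [exact: cO|..] => n;
    have [] := HO (compl_char (sval X)) (radius_name (sval X) (r X)) _ _ n => //;
    try exact: compl_char_name; move=> x a _ xa; apply: radius_nameP => //;
    by rewrite /r (to_name_id xa) (MN _ _ xa).
have Dd X s n m : (s <= 1)%N -> Delta (compl_char (sval X))
    (radius_name (sval X) (r X)) E2 s n m = Some (d X s n m).
  have [U [a [b [_ _ Ha Hb]]]] := dP X; rewrite /d.
  by case: s => [|[|//]] _; [have [y _ ->] := Ha n | have [y _ ->] := Hb n].
have [ev Hev] : comp (push tyN ΓV) (fun p => nat_of_bool `[< ~ covers (d p.2) >]).
  apply: (comp_push tyN (f := fun X => nat_of_bool `[< ~ covers (d X) >])).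
  by apply: compP_not; apply: (@compP_covers _ _ _ M Delta r); try solve_has.
have coversP (X : V) : covers (d X) <-> cset (sval X) = set0.
  have [U [a [b [UE code Ha Hb]]]] := dP X.
  have dea n : real_name (d X 0 n) (a n).
    by have [y ya E] := Ha n; rewrite /d (_ : (fun m => _) = y)//;
      apply/funext => m; rewrite E.
  have deb n : real_name (d X 1 n) (b n).
    by have [y yb E] := Hb n; rewrite /d (_ : (fun m => _) = y)//;
      apply/funext => m; rewrite E.
  split=> [cov|X0].
    rewrite -subset0 => w Xw; have [|n /andP[aw wb]] :=
      covers_sub dea deb cov (c := embed R w).
      by have := embed_bounds R w; lra.
    have : U (embed R w) by rewrite code; exists n => //=; rewrite in_itv /= aw.
    by rewrite UE => -[_]; apply; exists w.
  apply: (sub_covers dea deb) => c cI.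
  have : U c.
    rewrite UE; split; first by lra.
    by move=> [w]; rewrite X0.
  by rewrite code => -[n _]; rewrite /= in_itv; exists n.
(* S4 runs the guard [eg] first, so its divergence is inherited; [ev] receives the value of the
   guard as an extra argument and ignores it. *)
exists (idx [:: 4; ev; eg]) => -[X []] n.
have valsE : args_of ((X, tt) : tup [:: ty2]) ++ [:: @parg ty_Musco M;
  @parg ty_Delta Delta; @targ ty2 E2] = vals Γ X by [].
rewrite valsE /=; set o := Omega_C X.
have fwd (hX : valid X) : forall b, kleene ev (num b :: vals Γ X)
    (nat_of_bool `[< ~ covers (d (exist _ X hX)) >]).
  by move=> b; have := Hev (b, exist _ X hX); rewrite vals_push.
have oE (hX : valid X) :
    o = Some (nat_of_bool `[< ~ covers (d (exist _ X hX)) >]).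
  rewrite /o /Omega_C asboolT// asbool_neg.
  rewrite (asbool_equiv_eq (coversP (exist _ X hX))) /=.
  by case: asbool.
split.
  move=> /kleene_inv[b /(Hg X).1 Hc Hn].
  have hX : valid X by apply: check_valid => u; exact: (Hc u 0%N).
  by rewrite (oE hX) (kleene_det (fwd hX b) Hn).
move=> on; have hX : valid X.
  by move: on; rewrite /o /Omega_C; case: asboolP.
have [b Mb] := musco_zero.
apply: (@S4 ev eg _ b).
  by apply: (Hg X).2 Mb => u _; apply: valid_check.
by move: on; rewrite (oE hX) => -[<-]; exact: fwd.
Qed.

End omega_from_musco.

(** * Computing a modulus functional and Delta *)

Fixpoint curry (T : Type) (l : seq ty) : (tup l -> T) -> arrow T (map tot l) :=
  match l with
  | [::] => fun F => F tt
  | s :: l' => fun F x => @curry T l' (fun y => F (x, y))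
  end.

Lemma apply_curry T l (F : tup l -> T) xi : apply (curry F) xi = F xi.
Proof.
elim: l F xi => [F []//|s l IH F [x xi]] /=.
by rewrite IH.
Qed.

(** By determinism every index defines a partial functional. Its computability, divergence included,
    is then automatic, and only its values on good inputs remain to be verified. *)
Lemma kleene_functional l oracles e : exists psi : part (Ty l),
  computable_in psi oracles /\
  forall xi n, kleene e (args_of xi ++ oracles) n ->
    @apply (option nat) l psi xi = Some n.
Proof.
pose run G := match pselect (exists n, kleene e G n) with
  | left h => Some (projT1 (cid h)) | right _ => None end.
have runP G n : kleene e G n <-> run G = Some n.
  rewrite /run; case: pselect => [h|nh]; last by split=> // en; case: nh; exists n.
  case: cid => m Hm /=; split=> [/(kleene_det Hm) ->//|[<-]//].
exists (curry (fun xi => run (args_of xi ++ oracles))).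
split=> [|xi n /runP]; last by rewrite apply_curry.
by exists e => xi n; rewrite apply_curry.
Qed.

(** * A modulus functional from Omega_C *)

Section musco_from_omega.
Variable R : realType.
Implicit Types (a b c e : R) (f : R -> R).

Definition upper_set f a (k m : nat) : set cantor_space :=
  [set w | [/\ unitI R a, `|a - value R 2 0 (cseq w)| <= 2 ^- m &
               f a + 2 ^- k <= f (value R 2 0 (cseq w))]].

Lemma upper_charE fh f x a k m : fun_name (unitI R) fh f -> real_name x a ->
  cset (upper_char fh x k m) = upper_set f a k m.
Proof.
move=> ff xa; apply/seteqP.
suff H w : cset (upper_char fh x k m) w <-> upper_set f a k m w.
  by split=> w /H.
have bw := cseq_binary w; have bn := bin_nameP R bw; have Ib := value2_unit R bw.
have nP : unitI R a -> near x (bin_name (cseq w)) m <->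
    `|a - value R 2 0 (cseq w)| <= 2 ^- m.
  by move: Ib; rewrite /unitI /= !in_itv /= => /andP[? _] /andP[? _]; apply: nearP.
have gP (Ia : unitI R a) := name_geDP k (ff _ _ Ia xa) (ff _ _ Ib bn).
rewrite /cset /upper_char /upper_set /ite /=; case: asboolP => H; split=> //.
  by move=> _; case: H => /(name_unitP xa) Ia [/(nP Ia) ? /(gP Ia) ?].
move=> [Ia h1 h2]; case: H; split; first exact/(name_unitP xa).
by split; [apply/(nP Ia) | apply/(gP Ia)].
Qed.

Lemma upper_closed f a k m : usco f -> closed (upper_set f a k m).
Proof.
move=> /uscoP uf; apply/closed_cylinderP => w Hw.
have bw := cseq_binary w; have Ib := value2_unit R bw.
have [Ia|nIa] := pselect (unitI R a); last by exists 0%N => w' _ [].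
have [h1|h1] := leP `|a - value R 2 0 (cseq w)| (2 ^- m); last first.
  have [n Hn] := exp2N_lt (e := `|a - value R 2 0 (cseq w)| - 2 ^- m) ltac:(
    by rewrite subr_gt0).
  exists n => w' /(value2_agree R bw (cseq_binary w')) ww' [_ h _].
  have := ler_distD (value R 2 0 (cseq w')) a (value R 2 0 (cseq w)).
  by rewrite [`|value R 2 0 (cseq w') - _|]distrC; lra.
have [h2|h2] := leP (f a + 2 ^- k) (f (value R 2 0 (cseq w))); first by case: Hw.
have [d d0 Hd] := uf _ Ib _ h2; have [n Hn] := exp2N_lt d0.
exists n => w' /(value2_agree R bw (cseq_binary w')) ww' [_ _].
rewrite leNgt => /negP; apply; apply: Hd; first exact/value2_unit/cseq_binary.
by rewrite distrC; apply: le_lt_trans ww' Hn.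
Qed.

Definition modulus_spec f a (k m : nat) : Prop :=
  [/\ unitI R a,
      forall y, unitI R y -> `|a - y| <= 2 ^- m -> f y < f a + 2 ^- k &
      forall i j : nat, (j <= 2 ^ i)%N -> `|a - j%:R / 2 ^+ i| <= 2 ^- m ->
        f a - 2 ^- k.+1 <= f (j%:R / 2 ^+ i)].

Lemma omega_ite (X : tot ty2) : is_char X -> closed (cset X) ->
  Omega_C X = Some (if `[< cset X = set0 >] then 0%N else 1%N).
Proof. by move=> cX clX; rewrite /Omega_C asboolT. Qed.

Lemma omega_zero (X : tot ty2) : is_char X -> closed (cset X) ->
  Omega_C X = Some 0%N <-> cset X = set0.
Proof.
by move=> cX clX; rewrite omega_ite//; case: asboolP => X0; split=> // -[].
Qed.

Lemma ite_char (P : (nat -> nat) -> Prop) : is_char (fun z => ite (P z) 1 0).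
Proof. by move=> z; rewrite /ite; case: asbool. Qed.

Lemma dyadic_unit (i j : nat) : (j <= 2 ^ i)%N -> unitI R (j%:R / 2 ^+ i).
Proof.
move=> ji; rewrite /unitI /= in_itv /= divr_ge0 ?ler_pdivrMr ?exp2_gt0//.
by rewrite mul1r -natrX ler_nat.
Qed.

Lemma modulus_propP fh f x a k m : usco f -> fun_name (unitI R) fh f ->
  real_name x a -> modulus_prop fh x k m <-> modulus_spec f a k m.
Proof.
move=> uf ff xa; have cE := upper_charE k m ff xa.
have clX := upper_closed (a := a) (k := k) (m := m) uf; rewrite -cE in clX.
have oP := omega_zero (ite_char _) clX.
have dP i j : (j <= 2 ^ i)%N -> unitI R a ->
    (near x (dyadic_name j i) m <-> `|a - j%:R / 2 ^+ i| <= 2 ^- m) /\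
    (name_geB (fh x) (fh (dyadic_name j i)) k.+1 <->
     f a - 2 ^- k.+1 <= f (j%:R / 2 ^+ i)).
  move=> ji Ia; have Ij := dyadic_unit ji; have dn := dyadic_nameP R j i.
  split; last exact: name_geBP (ff _ _ Ia xa) (ff _ _ Ij dn).
  by move: Ia Ij; rewrite /unitI /= !in_itv /= => /andP[? _] /andP[? _];
    apply: nearP.
split=> [[/(name_unitP xa) Ia [/oP X0 H]]|[Ia H1 H2]].
  split=> // [y Iy ay|i j ji].
    have [w wy] := value2_surj Iy; rewrite ltNge; apply/negP => fy.
    have : cset (upper_char fh x k m) w by rewrite cE; split; rewrite ?wy.
    by rewrite X0.
  by move=> /(dP i j ji Ia).1 /(H i j ji) /(dP i j ji Ia).2.
split; first exact/(name_unitP xa).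
split=> [|i j ji /(dP i j ji Ia).1 /(H2 i j ji) /(dP i j ji Ia).2 //].
apply/oP; rewrite -subset0 cE => w [_ aw]; rewrite leNgt => /negP; apply.
by apply: H1 aw; exact/value2_unit/cseq_binary.
Qed.

Lemma exp2NS n : 2 ^- n = 2 * 2 ^- n.+1 :> R.
Proof. by rewrite exprS invfM mulrA mulfV ?mul1r. Qed.

Lemma modulus_exists f a k : usco f -> cont_points f a ->
  exists m, modulus_spec f a k m.
Proof.
move=> /uscoP uf /cont_pointP[Ia cf].
have e0 n : 0 < 2 ^- n :> R by rewrite invr_gt0 exp2_gt0.
have [d1 d10 H1] := uf a Ia (f a + 2 ^- k) ltac:(by rewrite ltrDl).
have [d2 d20 H2] := cf _ (e0 k.+1).
have [m Hm] := exp2N_lt (e := Num.min d1 d2) ltac:(by rewrite lt_min d10).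
move: Hm; rewrite lt_min => /andP[m1 m2].
exists m; split=> // [y Iy ay|i j ji ay].
  by apply: H1 => //; rewrite distrC; apply: le_lt_trans ay m1.
have := H2 _ (dyadic_unit ji); rewrite distrC => /(_ (le_lt_trans ay m2)).
by rewrite ltr_norml; lra.
Qed.

Lemma modulus_least f : usco f ->
  is_modulus f (fun a k => least (modulus_spec f a k)).
Proof.
move=> uf k a y ca Iy; have [+ _] := leastP (modulus_exists k uf ca).
move: (least _) => m [Ia H1 H2] ay; rewrite ltr_norml.
have := H1 y Iy (ltW ay) => H1y; suff : f a - 2 ^- k.+1 <= f y.
  have : 0 < 2 ^- k.+1 :> R by rewrite invr_gt0 exp2_gt0.
  by have := exp2NS k; lra.
rewrite leNgt; apply/negP => fy.
have [d d0 Hd] := (uscoP f).1 uf y Iy _ fy.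
(* Since |a - y| < 2^-m is strict, a dyadic point near y is still within 2^-m of a; [d] keeps it
   where f is too small. *)
have [i Hi] := exp2N_lt (e := Num.min d (2 ^- m - `|a - y|)) ltac:(
  by rewrite lt_min d0 subr_gt0).
move: Hi; rewrite lt_min => /andP[i1 i2].
have [y0 y1] : 0 <= y /\ y <= 1 by move: Iy; rewrite /unitI /= in_itv => /andP.
have [|j /andP[j1 j2]] := @nat_floor R (y * 2 ^+ i).
  by rewrite mulr_ge0// ltW ?exp2_gt0.
have ji : (j <= 2 ^ i)%N.
  rewrite -(ler_nat R) natrX; apply: le_trans j1 _.
  by rewrite ler_piMl// ltW ?exp2_gt0.
have yj : `|y - j%:R / 2 ^+ i| <= 2 ^- i.
  rewrite -[leRHS]mul1r norm_scaled ?exp2_gt0// mulrBl divfK ?gt_eqF ?exp2_gt0//.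
  lra.
have H : f a - 2 ^- k.+1 <= f (j%:R / 2 ^+ i).
  by apply: H2 => //; have := ler_distD y a (j%:R / 2 ^+ i); lra.
move: H; rewrite leNgt => /negP; apply.
apply: Hd (dyadic_unit ji) _.
by rewrite distrC; apply: le_lt_trans yj i1.
Qed.

Lemma musco_from_omega : exists M : part ty_Musco, is_Musco R M /\
  @computable_in ty_Musco M [:: @parg (Ty [:: ty2]) Omega_C; @targ ty2 E2].
Proof.
pose good (p : tot ty11 * ((nat -> nat) * nat)) := exists (f : R -> R) (a : R),
  [/\ usco f, fun_name (unitI R) p.1 f & real_name p.2.1 a].
pose W := {p | good p}.
pose Γ : ctx W := [:: fun w => @targ ty11 (sval w).1;
  fun w => @targ ty1 (sval w).2.1; fun w => num (sval w).2.2;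
  fun=> @parg (Ty [:: ty2]) Omega_C; fun=> @targ ty2 E2].
pose o (w : W) m :=
  odflt 0%N (Omega_C (upper_char (sval w).1 (sval w).2.1 (sval w).2.2 m)).
have [e He] : comp Γ (fun w =>
    least (modulus_prop (sval w).1 (sval w).2.1 (sval w).2.2)).
  apply: (@comp_modulus W Γ (fun w => (sval w).1) (fun w => (sval w).2.1)
    (fun w => (sval w).2.2) o); try solve_has.
  - by apply: comp1_var; solve_has.
  - by apply: comp_num; solve_has.
  - move=> [[fh [x k]] [f [a [uf ff xa]]]] m; rewrite /o /= omega_ite//.
      exact: ite_char.
    by rewrite (upper_charE k m ff xa); apply: upper_closed.
have [M [cM MP]] := kleene_functional [:: ty11; ty1; tyN]
  [:: @parg (Ty [:: ty2]) Omega_C; @targ ty2 E2] e.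
exists M; split=> //.
exists (fun f a k => least (modulus_spec f a k)) => f uf.
split=> [|fh ff x a k xa]; first exact: modulus_least.
have g : good (fh, (x, k)) by exists f, a.
rewrite -(eq_least (fun m => modulus_propP k m uf ff xa)).
exact: (MP (fh, (x, (k, tt))) _ (He (exist _ _ g))).
Qed.

End musco_from_omega.

(** * Codes of open sets from Omega_C *)

Section delta_from_omega.
Variable R : realType.
Implicit Types (U : set R) (Y : R -> R).

Lemma levelP n : (n < 2 ^ (level n).+1)%N.
Proof.
have [|//] := @leastP (fun i => n.+1 <= 2 ^ i.+1)%N.
by exists n; apply: (ltn_trans (@ltn_expl 2 n isT)); rewrite ltn_exp2l.
Qed.

Lemma level_offset i j : (j < 2 ^ i)%N ->
  level (2 ^ i + j) = i /\ offset (2 ^ i + j) = j.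
Proof.
move=> ji; have H : level (2 ^ i + j) = i.
  have iP : ((2 ^ i + j).+1 <= 2 ^ i.+1)%N by rewrite expnS; lia.
  have [|_ /(_ _ iP) le_i] := @leastP (fun l => (2 ^ i + j).+1 <= 2 ^ l.+1)%N.
    by exists i.
  apply/eqP; rewrite eqn_leq le_i leqNgt; apply/negP => lt_i.
  have := levelP (2 ^ i + j); rewrite ltnNge; apply/negP; rewrite negbK.
  by apply: leq_trans (leq_addr _ _); rewrite leq_exp2l.
by split=> //; rewrite /offset H addKn.
Qed.

Lemma offset_lt n : (offset n < 2 ^ level n)%N.
Proof.
rewrite /offset; have := levelP n; rewrite expnS.
have : (0 < 2 ^ level n)%N by rewrite expn_gt0.
by lia.
Qed.

(** The midpoint of the interval coded by n; it stays in [0, 1] even when the right endpoint exceeds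
    1. *)
Definition center n : R := (offset n + 1)%N%:R / 2 ^+ level n.

Lemma center_unit n : unitI R (center n).
Proof. by apply: dyadic_unit; rewrite addn1 offset_lt. Qed.

Definition outside_set U n : set cantor_space :=
  [set w | `|center n - value R 2 0 (cseq w)| <= 2 ^- level n /\
           ~ U (value R 2 0 (cseq w))].

Lemma outside_charE Oh U n : set_name Oh U ->
  cset (outside_char Oh n) = outside_set U n.
Proof.
move=> OU; apply/seteqP.
suff H w : cset (outside_char Oh n) w <-> outside_set U n w.
  by split=> w /H.
have bw := cseq_binary w; have bn := bin_nameP R bw; have Iw := value2_unit R bw.
have nP : near (dyadic_name (offset n + 1) (level n)) (bin_name (cseq w)) (level n)
    <-> `|center n - value R 2 0 (cseq w)| <= 2 ^- level n.
  move: Iw (center_unit n); rewrite /unitI /= !in_itv /= => /andP[? _] /andP[? _].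
  by apply: nearP => //; exact: dyadic_nameP.
have UP : ~ Oh (bin_name (cseq w)) = 1%N <-> ~ U (value R 2 0 (cseq w)).
  by rewrite (OU _ _ bn); case: asboolP => ?; split.
rewrite /cset /outside_char /outside_set /ite /=; case: asboolP => H; split=> //.
  by case: H => /nP ? /UP ?.
by move=> [/nP h1 /UP h2]; case: H.
Qed.

Lemma outside_closed U Y n : R2_open U Y -> closed (outside_set U n).
Proof.
move=> [_ oU]; apply/closed_cylinderP => w Hw.
have bw := cseq_binary w; set b := value R 2 0 (cseq w) in Hw.
have [h1|h1] := leP `|center n - b| (2 ^- level n); last first.
  have [m Hm] := exp2N_lt (e := `|center n - b| - 2 ^- level n) ltac:(
    by rewrite subr_gt0).
  exists m => w' /(value2_agree R bw (cseq_binary w')); rewrite -/b => ww' [h _].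
  have := ler_distD (value R 2 0 (cseq w')) (center n) b.
  by rewrite [`|value R 2 0 (cseq w') - _|]distrC; lra.
have Ub : U b by apply: contrapT => nU; apply: Hw.
have [Yb bU] := (oU b).1 Ub.
have [m Hm] := exp2N_lt Yb.
exists m => w' /(value2_agree R bw (cseq_binary w')); rewrite -/b => ww' [_].
by apply; apply: bU; rewrite /ball /=; apply: le_lt_trans ww' Hm.
Qed.

Definition cell_inside U n : Prop :=
  forall y, unitI R y -> `|center n - y| <= 2 ^- level n -> U y.

Lemma cell_insideP Oh U Y n : R2_open U Y -> set_name Oh U ->
  Omega_C (outside_char Oh n) = Some 0%N <-> cell_inside U n.
Proof.
move=> oU OU; have cE := outside_charE n OU.
have clX := outside_closed (n := n) oU; rewrite -cE in clX.
have oP := omega_zero (ite_char _) clX.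
apply: (iff_trans oP); split=> [X0 y Iy cy|H].
  have [w wy] := value2_surj Iy; apply: contrapT => nU.
  have : cset (outside_char Oh n) w by rewrite cE; split; rewrite wy.
  by rewrite X0.
rewrite -subset0 cE => w [cw]; apply; apply: H cw.
exact/value2_unit/cseq_binary.
Qed.

Definition endpoint U (s n : nat) : R :=
  if `[< cell_inside U n >] then (offset n + 2 * s)%N%:R / 2 ^+ level n else 0.

Lemma endpoint_nameP Oh U Y s n : R2_open U Y -> set_name Oh U ->
  real_name (endpoint_name Oh s n) (endpoint U s n).
Proof.
move=> oU OU; have cP := asbool_equiv_eq (cell_insideP n oU OU).
apply/real_nameP => m; rewrite /endpoint_name /endpoint /approx /ite cP.
case: asbool; first exact: (real_nameP _ _).1 (dyadic_nameP R _ _) m.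
by rewrite -[0%N]/(2 * 0)%N npos_double nneg_double mul0r subrr subr0; lra.
Qed.

Lemma endpoint_RM_code U Y : R2_open U Y ->
  RM_code U (endpoint U 0) (endpoint U 1).
Proof.
move=> [UI oU]; apply/seteqP; split=> [x Ux|x [n _]].
  have [Yx bU] := (oU x).1 Ux.
  (* The centre is within 2^-i of x and the cell has radius 2^-i, so the cell lies within 2 * 2^-i <
     Y x of x. *)
  have [i Hi] := exp2N_lt (e := Y x / 2) ltac:(by rewrite divr_gt0).
  have i0 : 0 < 2 ^- i :> R by rewrite invr_gt0 exp2_gt0.
  have sub y : `|x - y| < Y x -> 0 <= y <= 1.
    by move=> xy; have := UI y (bU y xy); rewrite /unitI /= in_itv.
  have x2 : 2 * 2 ^- i <= x.
    have /sub : `|x - (x - 2 * 2 ^- i)| < Y x.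
      by rewrite opprB addrC subrK ger0_norm; lra.
    lra.
  have x1 : x < 1.
    have /sub : `|x - (x + 2 ^- i)| < Y x.
      by rewrite opprD addrA subrr sub0r normrN ger0_norm; lra.
    lra.
  have q0 := exp2_gt0 R i.
  have qi : 2 ^- i * 2 ^+ i = 1 :> R by rewrite mulVf// gt_eqF.
  have [|k /andP[k1 k2]] := @nat_floor R (x * 2 ^+ i).
    by rewrite mulr_ge0//; lra.
  have k0 : (0 < k)%N.
    rewrite -ltnS -(ltr_nat R) -[k.+1%:R]natr1; apply: le_lt_trans k2.
    have : 2 * 2 ^- i * 2 ^+ i <= x * 2 ^+ i by rewrite ler_pM2r.
    by rewrite -mulrA qi; lra.
  (* Taking j = k - 1 puts x in the right half of the cell, strictly beyond its left endpoint; k > 0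
     because the ball about x stays in [0, 1]. *)
  have [j kE] : exists j, k = j.+1 by exists k.-1; rewrite prednK.
  have ji : (j < 2 ^ i)%N.
    rewrite -(ler_nat R) natrX -kE; apply: le_trans k1 _.
    by rewrite ler_piMl//; lra.
  have [lE fE] := level_offset ji.
  move: k1 k2; rewrite {}kE -natr1 => k1 k2.
  have inside : cell_inside U (2 ^ i + j).
    move=> y _; rewrite /center lE fE => cy; apply: bU; rewrite /ball/=.
    have : `|x - (j + 1)%N%:R / 2 ^+ i| <= 2 ^- i.
      rewrite -[leRHS]mul1r norm_scaled// mulrBl divfK ?gt_eqF// natrD.
      by lra.
    by have := ler_distD ((j + 1)%N%:R / 2 ^+ i) x y; lra.
  exists (2 ^ i + j)%N => //; rewrite /endpoint asboolT// lE fE /= in_itv /=.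
  by rewrite ltr_pdivrMr// ltr_pdivlMr// muln0 addn0 muln1 natrD; lra.
rewrite /endpoint; case: asboolP => [inside|_]; last first.
  by rewrite /= in_itv /= => /andP[h1 h2]; exfalso; lra.
have q0 := exp2_gt0 R (level n); rewrite /= in_itv /=.
rewrite ltr_pdivrMr// ltr_pdivlMr// muln0 addn0 muln1 natrD => /andP[h1 h2].
have x0 : 0 <= x.
  rewrite leNgt; apply/negP => x0.
  have : x * 2 ^+ level n < 0 by rewrite pmulr_llt0.
  by have := ler0n R (offset n); lra.
have near_c y : (offset n)%:R <= y * 2 ^+ level n <= (offset n)%:R + 2 ->
    `|center n - y| <= 2 ^- level n.
  move=> hy; rewrite -[leRHS]mul1r norm_scaled// mulrBl divfK ?gt_eqF// natrD.
  by lra.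
have [x1|x1] := leP x 1.
  by apply: inside; [rewrite /unitI /= in_itv /= x0 | apply: near_c; lra].
(* The last cell of a level sticks out of [0, 1]. If it were accepted, 1 would belong to U together
   with a ball around it, against U being contained in [0, 1]. *)
have U1 : U 1.
  apply: inside; first by rewrite /unitI /= in_itv /= ler01 lexx.
  apply: near_c; rewrite mul1r; apply/andP; split.
    by rewrite -natrX ler_nat ltnW// offset_lt.
  have : 1 * 2 ^+ level n < x * 2 ^+ level n by rewrite ltr_pM2r.
  by lra.
have [Y1 bU] := (oU 1).1 U1.
have /UI : U (1 + Y 1 / 2).
  by apply: bU; rewrite /ball /= opprD addrA subrr sub0r normrN ger0_norm; lra.
by rewrite /unitI /= in_itv /=; lra.
Qed.

Lemma delta_from_omega : exists D : part ty_Delta, is_Delta R D /\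
  @computable_in ty_Delta D [:: @parg (Ty [:: ty2]) Omega_C; @targ ty2 E2].
Proof.
pose good (p : tot ty2 * (tot ty11 * (tot ty2 * (nat * (nat * nat))))) :=
  exists U Y, R2_open U Y /\ set_name p.1 U.
pose W := {p | good p}.
pose Γ : ctx W := [:: fun w => @targ ty2 (sval w).1;
  fun w => @targ ty11 (sval w).2.1; fun w => @targ ty2 (sval w).2.2.1;
  fun w => num (sval w).2.2.2.1; fun w => num (sval w).2.2.2.2.1;
  fun w => num (sval w).2.2.2.2.2;
  fun=> @parg (Ty [:: ty2]) Omega_C; fun=> @targ ty2 E2].
pose o (w : W) :=
  odflt 0%N (Omega_C (outside_char (sval w).1 (sval w).2.2.2.2.1)).
have [e He] : comp Γ (fun w => endpoint_name (sval w).1 (sval w).2.2.2.1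
    (sval w).2.2.2.2.1 (sval w).2.2.2.2.2).
  apply: (@comp_endpoint_name W Γ (fun w => (sval w).1)
    (fun w => (sval w).2.2.2.1) (fun w => (sval w).2.2.2.2.1)
    (fun w => (sval w).2.2.2.2.2) o); try solve_has;
    try (by apply: comp_num; solve_has).
  move=> [[Oh [Yh [Eh [s [n m]]]]] [U [Y [oU OU]]]]; rewrite /o /= omega_ite//.
    exact: ite_char.
  by rewrite (outside_charE n OU); apply: outside_closed oU.
have [D [cD DP]] := kleene_functional [:: ty2; ty11; ty2; tyN; tyN; tyN]
  [:: @parg (Ty [:: ty2]) Omega_C; @targ ty2 E2] e.
exists D; split=> //.
exists (fun U _ => endpoint U 0), (fun U _ => endpoint U 1) => U Y oU.
split=> [|Oh Yh OU _ n]; first exact: endpoint_RM_code oU.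
have Dm s m : D Oh Yh E2 s n m = Some (endpoint_name Oh s n m).
  have g : good (Oh, (Yh, (E2, (s, (n, m))))) by exists U, Y.
  exact: (DP (Oh, (Yh, (E2, (s, (n, (m, tt)))))) _ (He (exist _ _ g))).
by split; [exists (endpoint_name Oh 0 n) | exists (endpoint_name Oh 1 n)] => //;
  apply: endpoint_nameP oU OU.
Qed.

End delta_from_omega.

Theorem theorem2p11 (R : realType) :
  (forall (M : part ty_Musco) (Delta : part ty_Delta),
      is_Musco R M -> is_Delta R Delta ->
      @computable_in (Ty [:: ty2]) Omega_C
        [:: @parg ty_Musco M; @parg ty_Delta Delta; @targ ty2 E2])
  /\
  (exists (M : part ty_Musco) (Delta : part ty_Delta),
      [/\ is_Musco R M,
          is_Delta R Delta,
          @computable_in ty_Musco M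
            [:: @parg (Ty [:: ty2]) Omega_C; @targ ty2 E2] &
          @computable_in ty_Delta Delta
            [:: @parg (Ty [:: ty2]) Omega_C; @targ ty2 E2]]).
Proof.
split=> [M Delta|]; first exact: omega_from_musco.
have [M [? ?]] := musco_from_omega R; have [D [? ?]] := delta_from_omega R.
by exists M, D.
Qed.
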